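(* Let $1\le i_1\le i_2\le\cdots\le i_n$ be integers, $\mathbf{i}=(i_1,\ldots,i_n)$, $\ell=\sum_{j} i_j$, and $\mathrm{Hom}(\mathbf{i}):=\mathrm{Hom}\big(C_\ell,\prod_{j=1}^n C_{i_j}\big)$. There exists an optimal acyclic (discrete Morse) matching on the face poset of $\mathrm{Hom}(\mathbf{i})$ such that the incidence number in the resulting Morse complex between any pair of critical cells is zero. Thus the homology groups of $\mathrm{Hom}(\mathbf{i})$ are free and the rank of $H_k(\mathrm{Hom}(\mathbf{i});\mathbb{Z})$ equals the number of critical cells of dimension $k$ in the matching. Furthermore, the critical cells of the matching are in bijection with the permutations $w$ of the multiset $\{1^{i_1},2^{i_2},\ldots,n^{i_n}\}$ whose descent set can be written as a disjoint union $$\mathrm{Des}(w)=\biguplus_t\{m_t,m_t+1,\ldots,m_t+q_t\}$$ where each $q_t$ is of the form $3j+1$ or $3j+2$ for some integer $j\ge 0$ and $\mathrm{Des}(w)\cap\bigcup_t\{m_t-1,m_t+q_t+1\}=\emptyset$; the dimension of the critical cell corresponding to such $w$ is $\sum_t\lceil q_t/3\rceil$.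
   Context: $C_k$ denotes the chain $0<1<\cdots<k$; $\prod_j C_{i_j}$ is the product poset (a distributive lattice of rank $\ell$). For finite posets $A,B$, $\mathrm{Hom}(A,B)$ is the subcomplex of the product of simplices $\prod_{a\in A}\Delta_B$ whose cells are tuples $(X_a)_{a\in A}$ of nonempty subsets of $B$ such that every map $\eta:A\to B$ with $\eta(a)\in X_a$ for all $a$ is strictly order-preserving; the cell $(X_a)$ is the product of the simplices $\Delta_{X_a}$, and the face poset is ordered by componentwise inclusion. Thus vertices of $\mathrm{Hom}(\mathbf{i})$ are maximal chains of $\prod_j C_{i_j}$. An acyclic matching on the face poset is a set of disjoint covering pairs admitting no cycle $a_1\prec u(a_1)\succ a_2\prec u(a_2)\succ\cdots\prec u(a_m)\succ a_1$ ($m\ge2$, distinct $a_i$); unmatched cells are critical, and by discrete Morse theory the complex is homotopy equivalent to a Morse complex with one $k$-cell per critical $k$-cell, with incidence numbers computed as weighted sums over alternating paths. The matching is optimal if for each $k$ the number of critical $k$-cells is as small as possible (equal to the minimal number forced by homology). For a word $w=w_1\cdots w_\ell$, $\mathrm{Des}(w)=\{j: w_j>w_{j+1}\}$. *)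

(* Defs.v *)
From HB Require Import structures.
From mathcomp Require Import all_boot all_order all_algebra.
From mathcomp Require Import boolp.

Set Implicit Arguments.
Unset Strict Implicit.
Unset Printing Implicit Defensive.

Import Order.TTheory GRing.Theory.
Local Open Scope ring_scope.

Section Matching.
Variables (d : Order.disp_t) (P : finPOrderType d).
Implicit Types (x y : P) (M : {set P * P}).

Definition covered x y : bool :=
  (x < y)%O && ~~ [exists z, (x < z)%O && (z < y)%O].

(* A pair (a, b) in M stands for a and u(a) = b. *)
Definition matching M : Prop :=
  (forall p, p \in M -> covered p.1 p.2) /\
  (forall p q, p \in M -> q \in M -> p != q ->
     [/\ p.1 != q.1, p.1 != q.2, p.2 != q.1 & p.2 != q.2]).

(* The sequence s lists the pairs (a_1, u(a_1)), ..., (a_m, u(a_m)). *)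
Definition alternating_cycle M (s : seq (P * P)) : bool :=
  [&& (2 <= size s)%N, all (mem M) s, uniq [seq p.1 | p <- s]
    & cycle [rel p q : P * P | covered q.1 p.2] s].

Definition acyclic_matching M : Prop :=
  matching M /\ forall s, ~~ alternating_cycle M s.

Definition critical M : {set P} :=
  [set x | [forall p in M, (x != p.1) && (x != p.2)]].

Definition critical_dim (dim : P -> nat) M k : {set P} :=
  [set x in critical M | dim x == k].

Definition optimal_matching (dim : P -> nat) M : Prop :=
  acyclic_matching M /\
  forall M', acyclic_matching M' ->
    forall k, (#|critical_dim dim M k| <= #|critical_dim dim M' k|)%N.

(* An alternating path s > a_1 < u(a_1) > a_2 < ... < u(a_m) > t is given by
   the sequence r of its matched pairs (a_i, u(a_i)); its descending steps are
   the pairs in zip (upper_cells s r) (lower_cells t r). *)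
Definition upper_cells (s : P) (r : seq (P * P)) : seq P :=
  s :: [seq p.2 | p <- r].
Definition lower_cells (t : P) (r : seq (P * P)) : seq P :=
  rcons [seq p.1 | p <- r] t.

Definition alternating_path M (s t : P) (r : seq (P * P)) : bool :=
  [&& all (mem M) r, uniq r
    & all2 (fun b a => covered a b) (upper_cells s r) (lower_cells t r)].

(* inc y x is the incidence number [y : x], which is 1 or -1 on covering pairs,
   so that the inverses [u(a_i) : a_i]^-1 may be written [u(a_i) : a_i]. *)
Definition path_weight (inc : P -> P -> int) (s t : P) (r : seq (P * P)) : int :=
  (-1) ^+ size r * (\prod_(p <- r) inc p.2 p.1) *
  \prod_(q <- zip (upper_cells s r) (lower_cells t r)) inc q.1 q.2.

(* The pairs along an alternating path are distinct elements of M, which bounds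
   its length by #|M|. *)
Definition morse_incidence (inc : P -> P -> int) M (s t : P) : int :=
  \sum_(m < #|M|.+1) \sum_(r : m.-tuple (P * P) | alternating_path M s t r)
    path_weight inc s t r.

End Matching.

(* Cellular homology over the integers of a finite regular cell complex with
   cells P and incidence numbers inc y x = [y : x].  A k-chain is a function on
   all cells supported on the k-cells, so that H_0 needs no special treatment
   and is unreduced. *)

Section Homology.
Variables (P : finType) (dim : P -> nat) (inc : P -> P -> int).
Implicit Types (c : {ffun P -> int}) (k : nat).

Definition chain_bd c : {ffun P -> int} :=
  [ffun x => \sum_y c y * inc y x].

Lemma chain_bdB : {morph chain_bd : c c' / c - c'}.
Proof.
move=> c c'; apply/ffunP => x; rewrite !ffunE -sumrB.
by apply: eq_bigr => y _; rewrite !ffunE mulrBl.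
Qed.

Lemma chain_bd0 : chain_bd 0 = 0.
Proof. by have := chain_bdB 0 0; rewrite !subrr. Qed.

Definition is_chain k c : bool := [forall x, (c x != 0) ==> (dim x == k)].

Lemma is_chain0 k : is_chain k 0.
Proof. by apply/forallP => x; rewrite ffunE eqxx. Qed.

Lemma is_chainB k c c' : is_chain k c -> is_chain k c' -> is_chain k (c - c').
Proof.
move=> /forallP hc /forallP hc'; apply/forallP => x; rewrite !ffunE.
have [//|xk] := eqVneq (dim x) k; first by rewrite implybT.
move: (hc x) (hc' x); rewrite (negPf xk) !implybF !negbK => /eqP-> /eqP->.
by rewrite subrr eqxx.
Qed.

Definition is_cycle k : {pred {ffun P -> int}} :=
  fun c => is_chain k c && (chain_bd c == 0).

Lemma is_cycle_closed k : zmod_closed (is_cycle k).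
Proof.
split; first by rewrite unfold_in is_chain0 chain_bd0 eqxx.
move=> c c' /andP[hc /eqP zc] /andP[hc' /eqP zc'].
by rewrite unfold_in is_chainB // chain_bdB zc zc' subrr eqxx.
Qed.

HB.instance Definition _ k :=
  GRing.isZmodClosed.Build {ffun P -> int} (is_cycle k) (is_cycle_closed k).

Record cycles k := Cycle { cycle_val : {ffun P -> int}; _ : cycle_val \in is_cycle k }.

HB.instance Definition _ k := [isSub for @cycle_val k].
HB.instance Definition _ k := [Choice of cycles k by <:].
HB.instance Definition _ k := [SubChoice_isSubZmodule of cycles k by <:].

Definition is_boundary k : {pred cycles k} :=
  fun z => `[< exists2 c, is_chain k.+1 c & chain_bd c = cycle_val z >].
Arguments is_boundary k : clear implicits.

Lemma is_boundary_closed k : zmod_closed (is_boundary k).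
Proof.
split.
  by apply/asboolP; exists 0; [exact: is_chain0 | rewrite chain_bd0].
move=> z z' /asboolP[c hc zc] /asboolP[c' hc' zc']; apply/asboolP.
exists (c - c'); first exact: is_chainB.
by rewrite chain_bdB zc zc'.
Qed.

HB.instance Definition _ k :=
  GRing.isZmodClosed.Build (cycles k) (is_boundary k) (is_boundary_closed k).

Definition homology k : zmodType := Quotient.quot (is_boundary k).

End Homology.

Definition free_of_rank (V : zmodType) (r : nat) : Prop :=
  exists f : {additive V -> 'rV[int]_r}, bijective f.

Fact hom_display : Order.disp_t. Proof. exact: (Order.Disp tt tt). Qed.

Section Hom.
Variables (dA dB : Order.disp_t) (A : finPOrderType dA) (B : finPOrderType dB).

Definition is_cell (X : {ffun A -> {set B}}) : bool :=
  [forall a, X a != set0] &&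
  [forall eta : {ffun A -> B}, [forall a, eta a \in X a] ==>
     [forall a, forall a', (a < a')%O ==> (eta a < eta a')%O]].

Record hom_cell := HomCell {
  cell_val :> {ffun A -> {set B}};
  _ : is_cell cell_val
}.

HB.instance Definition _ := [isSub for cell_val].
HB.instance Definition _ := [Finite of hom_cell by <:].

Implicit Types X Y Z : hom_cell.

Definition cell_le X Y : bool := [forall a, X a \subset Y a].

Lemma cell_le_refl : reflexive cell_le.
Proof. by move=> X; apply/forallP => a. Qed.

Lemma cell_le_anti : antisymmetric cell_le.
Proof.
move=> X Y /andP[/forallP XY /forallP YX]; apply/val_inj/ffunP => a.
by apply/eqP; rewrite eqEsubset XY YX.
Qed.

Lemma cell_le_trans : transitive cell_le.
Proof.
move=> Y X Z /forallP XY /forallP YZ; apply/forallP => a.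
exact: subset_trans (XY a) (YZ a).
Qed.

HB.instance Definition _ := Order.Le_isPOrder.Build hom_display hom_cell
  cell_le_refl cell_le_anti cell_le_trans.

Definition cell_dim X : nat := \sum_a #|X a|.-1.

Definition remove_vertex X (a : A) (b : B) : {ffun A -> {set B}} :=
  [ffun a' => if a' == a then X a' :\ b else X a'].

(* Every simplex is oriented by the enumeration order of B and products are
   taken in the enumeration order of A: removing b from X_a contributes
   (-1)^(sum of dim X_a' over a' before a + number of b' in X_a before b).
   At most one pair (a, b) contributes to the sum below. *)
Definition cell_incidence Y X : int :=
  \sum_(p : A * B | (p.2 \in Y p.1) && (cell_val X == remove_vertex Y p.1 p.2))
    (-1) ^+ (\sum_(a | (enum_rank a < enum_rank p.1)%N) #|Y a|.-1 +
             #|[set b in Y p.1 | (enum_rank b < enum_rank p.2)%N]|)%N.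

End Hom.

(* The chain C_k is 'I_k.+1. *)

Definition chain_prod n (i : 'I_n -> nat) : Type :=
  {dffun forall j : 'I_n, 'I_(i j).+1}.

HB.instance Definition _ n (i : 'I_n -> nat) := Finite.on (chain_prod i).

Section ChainProd.
Variables (n : nat) (i : 'I_n -> nat).
Implicit Types x y z : chain_prod i.

Definition chain_prod_le x y : bool := [forall j, (x j <= y j)%O].

Lemma chain_prod_le_refl : reflexive chain_prod_le.
Proof. by move=> x; apply/forallP => j. Qed.

Lemma chain_prod_le_anti : antisymmetric chain_prod_le.
Proof.
move=> x y /andP[/forallP xy /forallP yx]; apply/ffunP => j.
by apply/le_anti; rewrite xy yx.
Qed.

Lemma chain_prod_le_trans : transitive chain_prod_le.
Proof.
move=> y x z /forallP xy /forallP yz; apply/forallP => j.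
exact: le_trans (xy j) (yz j).
Qed.

HB.instance Definition _ := Order.Le_isPOrder.Build hom_display (chain_prod i)
  chain_prod_le_refl chain_prod_le_anti chain_prod_le_trans.

End ChainProd.

Definition ell n (i : 'I_n -> nat) : nat := \sum_j i j.

Definition Hom_i n (i : 'I_n -> nat) : finPOrderType hom_display :=
  hom_cell 'I_(ell i).+1 (chain_prod i).

(* Letters are numbered from 0, positions from 1. *)

Definition multiset_perm n (i : 'I_n -> nat) (w : (ell i).-tuple 'I_n) : Prop :=
  forall j, count_mem j w = i j.

Definition descents (w : seq nat) : seq nat :=
  [seq j <- iota 1 (size w).-1 | (nth 0%N w j < nth 0%N w j.-1)%N].

Definition Des n (i : 'I_n -> nat) (w : (ell i).-tuple 'I_n) : seq nat :=
  descents [seq val j | j <- w].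

(* s lists the pairs (m_t, q_t).  All elements of D being positive, so is each
   m_t, and m_t.-1 is m_t - 1. *)
Definition run_decomposition (D : seq nat) (s : seq (nat * nat)) : Prop :=
  let runs := flatten [seq iota p.1 p.2.+1 | p <- s] in
  [/\ uniq runs, D =i runs,
      (forall p, p \in s -> exists j, p.2 = (3 * j + 1)%N \/ p.2 = (3 * j + 2)%N)
    & forall p, p \in s -> p.1.-1 \notin D /\ (p.1 + p.2 + 1)%N \notin D].

Definition ceil_div3 (q : nat) : nat := ((q + 2) %/ 3)%N.

(* Main.v *)
(* A cell of Hom(i) has at most two elements in each rank, and no two
   consecutive ranks with two elements; so it is a word in the letters in which
   some disjoint pairs of adjacent, distinct letters are left unordered.  Writing
   such pairs in decreasing order, a cell is a word w together with an
   independent set of the path graph on Des(w), and passing to a face either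
   keeps w or makes it smaller.  The matching is the standard one on the
   independence complexes of the runs of Des(w): a run of length r contributes no
   critical cell if r = 1 mod 3, and otherwise one, which consists of disjoint
   triples x > b > a with the pair {a, b} unordered.

   Letting the letters of each triple run through all their orders turns a
   critical cell into a product of hexagons, that is, a cycle.  Over w this cycle
   contains, besides the critical cell, only cells that are matched downwards.
   Hence these cycles form a unitriangular system, every critical cell extends to
   a cycle whose other cells are all matched downwards, and the Morse
   differential vanishes. *)

Require Import Defs.
From HB Require Import structures.
From mathcomp Require Import all_boot all_order all_algebra.
From mathcomp Require Import boolp.
From mathcomp Require Import zify ring.

Set Implicit Arguments.
Unset Strict Implicit.
Unset Printing Implicit Defensive.

Import Order.TTheory GRing.Theory Num.Theory.
Local Open Scope quotient_scope.
Local Open Scope ring_scope.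

(** * Acyclic matchings and integral chains *)

(** Critical cells are never counted against Betti numbers. A chain is normalised modulo boundaries
    by clearing its coefficients at the lower cells of matched pairs; a normalised cycle is
    determined by its critical coefficients, since the boundary from upper to lower cells is
    triangular with units on the diagonal. One dual cycle per critical cell then gives freeness,
    vanishing incidences and optimality together. The obstacle is signs: incidence numbers depend on
    an enumeration of the vertices, which knows nothing of words. Each unordered pair gets a sign
    comparing this enumeration with the decreasing order of its letters; after this change of basis
    the boundary is a derivation sending a pair to a commutator, a hexagon is closed by the Jacobi
    identity, and products of cycles are cycles by the Leibniz rule. The condition on runs comes
    from a greedy reading of the word: a descent must open a triple, and the comparison after the
    last letter of a triple is free. *)

Section Potential.
Variables (d : Order.disp_t) (P : finPOrderType d) (M : {set P * P}).

(** A rank function for alternating paths: [q] may follow [p] when the lower cell of [q] is a facet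
    of the upper cell of [p]. It turns acyclicity into a principle of induction. *)
Definition decreasing_potential (rho : P * P -> nat) : Prop :=
  forall p q, p \in M -> q \in M -> p != q -> covered q.1 p.2 ->
    (rho q < rho p)%N.

Lemma matching_inj1 p q : matching M -> p \in M -> q \in M -> p.1 = q.1 -> p = q.
Proof.
move=> [_ Mdisj] pM qM e; apply/eqP; apply: contraT => pq.
by have [] := Mdisj _ _ pM qM pq; rewrite e eqxx.
Qed.

Lemma matching_inj2 p q : matching M -> p \in M -> q \in M -> p.2 = q.2 -> p = q.
Proof.
move=> [_ Mdisj] pM qM e; apply/eqP; apply: contraT => pq.
by have [_ _ _] := Mdisj _ _ pM qM pq; rewrite e eqxx.
Qed.

Lemma matching_lower_upper p q :
  matching M -> p \in M -> q \in M -> p.1 != q.2.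
Proof.
move=> [Mcov Mdisj] pM qM; have [<-|pq] := eqVneq p q.
  by have /andP[] := Mcov _ pM; rewrite lt_neqAle => /andP[].
by have [] := Mdisj _ _ pM qM pq.
Qed.

Lemma criticalPn x :
  reflect (exists2 p, p \in M & x = p.1 \/ x = p.2) (x \notin critical M).
Proof.
rewrite inE negb_forall; apply: (iffP existsP) => [[p]|[p pM e]].
  rewrite negb_imply negb_and !negbK => /andP[pM /orP[]/eqP e]; exists p => //.
    by left.
  by right.
exists p; rewrite negb_imply pM negb_and !negbK /=.
by case: e => ->; rewrite eqxx ?orbT.
Qed.

(** The number of pairs reachable from [p] decreases. A step to [q] loses [p] itself, since a path
    leading back from [q] would close up to an alternating cycle. *)
Lemma acyclic_potential : acyclic_matching M -> exists rho, decreasing_potential rho.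
Proof.
move=> [mM acM].
pose step := [rel p q : P * P | [&& p \in M, q \in M, p != q & covered q.1 p.2]].
exists (fun p => #|[set q | connect step p q]|) => p q pM qM pq cov.
have st : step p q by rewrite /= pM qM pq.
apply: proper_card; apply/properP; split.
  by apply/subsetP => r; rewrite !inE; apply: connect_trans; exact: connect1.
exists p; rewrite !inE ?connect0 //.
apply/negP => /connectP[s0 path_s0 ep].
(* An alternating cycle has distinct pairs, so repetitions are cut out of the path. *)
move: path_s0 ep; case/shortenP => s path_s uniq_s _ ep.
suff : alternating_cycle M (q :: s) by apply/negP.
have sM : all (mem M) s.
  elim: s {uniq_s ep} q {qM pq cov st} path_s => //= r s IH q.
  by move=> /andP[/and4P[_ rM _ _]] /IH ->; rewrite rM.
apply/and4P; split.
- by case: s ep {path_s uniq_s sM} => // e; rewrite e eqxx in pq.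
- by rewrite /= qM.
- rewrite map_inj_in_uniq //.
  move=> a b; rewrite !inE => ha hb; apply: matching_inj1 => //.
    by case/predU1P: ha => [->//|/(allP sM)].
  by case/predU1P: hb => [->//|/(allP sM)].
- rewrite /= rcons_path -ep /= cov andbT.
  by apply: sub_path path_s => a b /= /and4P[].
Qed.

Lemma potential_acyclic rho :
  matching M -> decreasing_potential rho -> acyclic_matching M.
Proof.
move=> mM rhoP; split=> // s; apply/negP => /and4P[s2 sM us cs].
have {us} us : uniq s by exact: map_uniq us.
have : cycle (fun p q => (rho q < rho p)%N) s.
  case: s s2 sM us cs => // p [//|q s] _ /allP sM us cs.
  move: cs; rewrite /= rcons_path => /and3P[h1 h2 h3].
  rewrite rcons_path; apply/and3P; split.
  - apply: rhoP => //; try by apply: sM; rewrite !inE eqxx ?orbT.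
    by move: us => /= /andP[]; rewrite inE negb_or => /andP[].
  - have {h1 h3} uqs : uniq (q :: s) by case/andP: us.
    have {sM us} qsM : all (mem M) (q :: s).
      by apply/allP => r hr; apply: sM; rewrite inE hr orbT.
    elim: s q h2 uqs qsM => //= r s IH q /andP[c1 c2] /and3P[q1 q2 q3].
    move=> /and3P[qM rM sM]; rewrite IH ?q2 ?q3 ?rM ?sM ?andbT //.
    by apply: rhoP => //; move: q1; rewrite inE negb_or => /andP[].
  - apply: rhoP => //; try (apply: sM; rewrite inE ?eqxx ?mem_last ?orbT //).
    by apply: contraTneq us => e; rewrite /= -{1}e mem_last.
case: s s2 {sM us cs} => // p s _ /=; rewrite rcons_path => /andP[ps].
have : transitive (fun p q => (rho q < rho p)%N) by move=> a b c h1 h2; apply: ltn_trans h1.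
move=> tr; move: ps; rewrite path_sortedE // => /andP[/allP al _].
have := mem_last p s; rewrite inE => /predU1P[->|/al]; first by rewrite ltnn.
by move=> h1 h2; have := ltn_trans h1 h2; rewrite ltnn.
Qed.

End Potential.

(** * Integral chains and integral linear relations *)

Section ChainAlgebra.
Variables (P : finType) (dim : P -> nat) (inc : P -> P -> int).
Implicit Types c : {ffun P -> int}.

HB.instance Definition _ :=
  GRing.isZmodMorphism.Build {ffun P -> int} {ffun P -> int}
    (@chain_bd P inc) (@chain_bdB P inc).

Lemma ffun_subE c c' x : (c - c') x = c x - c' x.
Proof. by rewrite !ffunE. Qed.

Lemma ffun_mulrz c (z : int) x : (c *~ z) x = c x * z.
Proof.
have -> : c x * z = c x *~ z by rewrite mulrzz.
case: z => m; first by rewrite -!pmulrn ffunMnE.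
by rewrite NegzE !mulrNz -!pmulrn ffunE ffunMnE.
Qed.

Lemma is_chainP k c : reflect (forall x, c x != 0 -> dim x = k) (is_chain dim k c).
Proof.
apply: (iffP forallP) => h x; first by move=> cx; apply/eqP/(implyP (h x)).
by apply/implyP => /h ->.
Qed.

Lemma is_chain_sum (I : Type) (r : seq I) (Q : pred I) k (F : I -> {ffun P -> int}) :
  (forall j, Q j -> is_chain dim k (F j)) ->
  is_chain dim k (\sum_(j <- r | Q j) F j).
Proof.
move=> h; elim/big_rec: _ => [|j c /h hj hc]; first exact: is_chain0.
by rewrite -[c]opprK is_chainB // -sub0r is_chainB // is_chain0.
Qed.

Lemma is_chain_mulz k c (z : int) : is_chain dim k c -> is_chain dim k (c *~ z).
Proof.
move=> /is_chainP h; apply/is_chainP => x; rewrite ffun_mulrz => cz.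
by apply: h; apply: contraNneq cz => ->; rewrite mul0r.
Qed.

End ChainAlgebra.

(** A rational kernel vector exists by rank; multiplying it by the product of its denominators makes
    it integral. *)
Lemma int_kernel (r m : nat) (A : 'M[int]_(r, m)) : (m < r)%N ->
  exists2 v : 'rV[int]_r, v != 0 & v *m A = 0.
Proof.
move=> mr; pose B := map_mx (fun z : int => z%:~R : rat) A.
have /rowV0Pn[u uK u0] : kermx B != 0.
  by rewrite kermx_eq0 /row_free ltn_eqF // (leq_ltn_trans (rank_leq_col _)).
have uB : u *m B = 0 by apply/sub_kermxP.
pose dn : rat := \prod_j (denq (u 0 j))%:~R.
have dn0 : dn != 0 by apply/prodf_neq0 => j _; rewrite intr_eq0 denq_neq0.
pose v : 'rV[int]_r := \row_j (numq (u 0 j) * \prod_(j' | j' != j) denq (u 0 j')).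
have vE j : (v 0 j)%:~R = u 0 j * dn :> rat.
  rewrite [dn](bigD1 j) //= mulrA mxE intrM rmorph_prod /=; congr (_ * _).
  have d0 : (denq (u 0 j))%:~R != 0 :> rat by rewrite intr_eq0 denq_neq0.
  by rewrite -[LHS](divfK d0) divq_num_den.
exists v.
  apply: contraNneq u0 => v0; apply/eqP/rowP => j; rewrite mxE.
  by have /esym/eqP := vE j; rewrite v0 mxE mulf_eq0 (negbTE dn0) orbF => /eqP.
apply/rowP => c; rewrite !mxE; apply: (@intr_inj rat); rewrite rmorph_sum /=.
have /rowP/(_ c) := uB; rewrite !mxE => e.
rewrite (eq_bigr (fun j => dn * (u 0 j * B j c))).
  by rewrite -mulr_sumr e mulr0.
by move=> j _; rewrite rmorphM /= vE mxE mulrA [dn * _]mulrC.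
Qed.

(** * Discrete Morse theory through chains without lower cells *)

Section Morse.
Variables (d : Order.disp_t) (P : finPOrderType d) (dim : P -> nat).
Variable inc : P -> P -> int.
Hypothesis inc_covered : forall x y, inc y x != 0 -> covered x y.
Hypothesis inc_sqr : forall x y, covered x y -> inc y x * inc y x = 1.
Hypothesis dim_covered : forall x y, covered x y -> dim y = (dim x).+1.
Hypothesis bd_bd : forall c, chain_bd inc (chain_bd inc c) = 0.

Local Notation bd := (chain_bd inc).
Implicit Types (M : {set P * P}) (c e : {ffun P -> int}).

Lemma bd_chain k c : is_chain dim k.+1 c -> is_chain dim k (bd c).
Proof.
move=> /is_chainP h; apply/is_chainP => x; rewrite ffunE => bx.
have [y] : exists y, c y * inc y x != 0.
  apply/existsP; apply: contraNT bx => /existsPn n0.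
  by rewrite big1 // => y _; apply/eqP; rewrite -[_ == _]negbK n0.
rewrite mulf_eq0 negb_or => /andP[/h dy /inc_covered/dim_covered].
by rewrite dy => -[->].
Qed.

Definition lower_free M c : Prop := forall p, p \in M -> c p.1 = 0.

(** A level that does not increase on passing to a face and agrees on the two cells of a pair, so
    that eliminations below a level leave everything above it untouched. *)
Definition filtration M (f : P -> nat) : Prop :=
  (forall x y, covered x y -> (f x <= f y)%N) /\
  (forall p, p \in M -> f p.1 = f p.2).

(** Gaussian elimination in decreasing order of [rho]: subtracting a multiple of the boundary of
    [p.2] clears [p.1] and otherwise disturbs only lower cells of smaller potential. If nothing is
    to be cleared from level [N] on, only upper cells below level [N] are used, and their boundaries
    stay there. *)
Lemma reduce_lower M rho f N k c :
    matching M -> decreasing_potential M rho -> filtration M f ->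
    is_chain dim k c ->
    (forall p, p \in M -> (N <= f p.1)%N -> c p.1 = 0) ->
  exists e, [/\ is_chain dim k.+1 e, lower_free M (c - bd e) &
    forall x, (N <= f x)%N -> bd e x = 0].
Proof.
move=> mM rhoP [fmono fM].
suff red r : forall c, is_chain dim k c ->
    (forall p, p \in M -> (N <= f p.1)%N -> c p.1 = 0) ->
    (forall p, p \in M -> (r <= rho p)%N -> c p.1 = 0) ->
  exists e, [/\ is_chain dim k.+1 e, lower_free M (c - bd e) &
    forall x, (N <= f x)%N -> bd e x = 0].
  move=> hc cN; apply: (red (\max_p rho p).+1) => // p pM.
  by move=> lt; have := leq_bigmax (F := rho) p; rewrite leqNgt lt.
elim: r => [|r IH] {}c ck cN cr.
  exists 0; split; first exact: is_chain0.
    by move=> p pM; rewrite chain_bd0 subr0 cr.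
  by move=> x _; rewrite chain_bd0 ffunE.
(* An incidence number on a covering pair is its own inverse, so this coefficient makes the boundary
   of the term of [p] agree with [c] at [p.1]. *)
pose e := [ffun y => \sum_(p in M | (rho p == r) && (p.2 == y))
                       c p.1 * inc p.2 p.1].
have bde x : bd e x =
    \sum_(p in M | rho p == r) c p.1 * inc p.2 p.1 * inc p.2 x.
  rewrite ffunE (eq_bigr (fun y => \sum_(p in M | (rho p == r) && (p.2 == y))
                       c p.1 * inc p.2 p.1 * inc p.2 x)); last first.
    move=> y _; rewrite ffunE mulr_suml.
    by apply: eq_bigr => p /and3P[_ _ /eqP->].
  rewrite (partition_big (fun p => p.2) predT) //=.
  by apply: eq_bigr => y _; apply: eq_bigl => p; rewrite andbA.
have ek : is_chain dim k.+1 e.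
  apply/is_chainP => y; rewrite ffunE => ey.
  have [p] : exists p, [&& p \in M, p.2 == y & c p.1 != 0].
    apply/existsP; apply: contraNT ey => /existsPn n0.
    rewrite big1 // => p /and3P[pM _ py].
    by have := n0 p; rewrite pM py /= negbK => /eqP->; rewrite mul0r.
  move=> /and3P[pM /eqP<-] /(is_chainP _ _ _ ck) <-.
  by apply: dim_covered; exact: mM.1.
have eN x : (N <= f x)%N -> bd e x = 0.
  move=> Nx; rewrite bde big1 // => p /andP[pM _].
  have [->|/inc_covered cov] := eqVneq (inc p.2 x) 0; first by rewrite mulr0.
  by rewrite cN ?mul0r // fM // (leq_trans Nx) // fmono.
have [||p pM|e' [e'k e'l e'N]] := IH (c - bd e).
- by rewrite is_chainB // bd_chain.
- by move=> p pM Np; rewrite ffun_subE eN // cN ?subr0.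
- rewrite leq_eqVlt eq_sym => /predU1P[pr|pr]; rewrite ffun_subE bde.
    rewrite (bigD1 p) /=; last by rewrite pM pr eqxx.
    rewrite big1 ?addr0.
      by rewrite -mulrA inc_sqr ?mulr1 ?subrr //; exact: mM.1.
    move=> q /andP[/andP[qM /eqP qr] qp].
    have [->|/inc_covered cov] := eqVneq (inc q.2 p.1) 0; first by rewrite mulr0.
    by have := rhoP _ _ qM pM qp cov; rewrite pr qr ltnn.
  rewrite cr // sub0r big1 ?oppr0 // => q /andP[qM /eqP qr].
  have [->|/inc_covered cov] := eqVneq (inc q.2 p.1) 0; first by rewrite mulr0.
  have qp : q != p by apply: contraTneq pr => <-; rewrite -qr ltnn.
  by have := rhoP _ _ qM pM qp cov; rewrite qr => /(ltn_trans pr); rewrite ltnn.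
exists (e + e'); split.
- have := is_chainB ek (is_chainB (is_chain0 dim k.+1) e'k).
  by rewrite sub0r opprK.
- by move=> p pM; rewrite raddfD opprD addrA e'l.
- by move=> x Nx; rewrite raddfD ffunE eN // e'N.
Qed.

(** Descending induction on [rho]: at [p.1] only [p.2] and upper cells of larger potential
    contribute to the boundary. *)
Lemma upper_chain_eq0 M rho c :
    matching M -> decreasing_potential M rho ->
    (forall x, c x != 0 -> exists2 p, p \in M & x = p.2) ->
    lower_free M (bd c) -> c = 0.
Proof.
move=> mM rhoP cup bdl.
suff z r : forall p, p \in M -> (\max_q rho q < r + rho p)%N -> c p.2 = 0.
  apply/ffunP => x; rewrite ffunE; apply/eqP; apply: contraT => cx.
  have [p pM xp] := cup _ cx; move: cx; rewrite xp (z (\max_q rho q).+1) ?eqxx //.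
  by rewrite ltnS leq_addr.
elim: r => [|r IH] p pM.
  by move=> lt; have := leq_bigmax (F := rho) p; rewrite leqNgt lt.
move=> lt; have := bdl p pM; rewrite ffunE (bigD1 p.2) //= big1 ?addr0.
  move=> /eqP; rewrite mulf_eq0 => /orP[/eqP//|/eqP i0].
  by have := inc_sqr (mM.1 p pM); rewrite i0 mul0r.
move=> y yp; have [->|cy] := eqVneq (c y) 0; first by rewrite mul0r.
have [->|/inc_covered cov] := eqVneq (inc y p.1) 0; first by rewrite mulr0.
have [q qM yq] := cup _ cy.
have qp : q != p by apply: contraNneq yp => <-; rewrite yq.
rewrite yq in cov; have rq := rhoP _ _ qM pM qp cov.
by rewrite yq IH ?mul0r // (leq_trans lt) // addSnnS leq_add2l.
Qed.

(** Such a cycle is [s] plus a combination of upper cells. *)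
Definition dual_cycle M s y : Prop :=
  [/\ is_chain dim (dim s) y, bd y = 0, lower_free M y &
      forall t, t \in critical M -> y t = (t == s)%:R].

Lemma sum_mulrzE (I : finType) (Q : pred I) (Y : I -> {ffun P -> int})
    (a : I -> int) x :
  (\sum_(t | Q t) Y t *~ a t) x = \sum_(t | Q t) Y t x * a t.
Proof. by rewrite sum_ffunE; apply: eq_bigr => t _; rewrite ffun_mulrz. Qed.

Lemma bd_sum_mulrz (I : finType) (Q : pred I) (Y : I -> {ffun P -> int})
    (a : I -> int) :
  (forall t, Q t -> bd (Y t) = 0) -> bd (\sum_(t | Q t) Y t *~ a t) = 0.
Proof.
by move=> h; rewrite raddf_sum big1 // => t /h e; rewrite raddfMz /= e mul0rz.
Qed.

(* Subtracting dual cycles found earlier makes the reduced cycle dual: it is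
   unitriangular with respect to the filtration. *)
Lemma dual_cycles M rho f :
    matching M -> decreasing_potential M rho -> filtration M f ->
    (forall s, s \in critical M -> exists z,
      [/\ is_chain dim (dim s) z, bd z = 0, z s * z s = 1 &
          forall x, z x != 0 -> (f s <= f x)%N ->
            x = s \/ exists2 p, p \in M & x = p.2]) ->
  exists Y, forall s, s \in critical M -> dual_cycle M s (Y s).
Proof.
move=> mM rhoP fP zP.
suff ex s : s \in critical M -> exists y, dual_cycle M s y.
  have [|Y YP] := @choice _ _ (fun s y => s \in critical M -> dual_cycle M s y).
    move=> s; have [sc|] := boolP (s \in critical M); last by exists 0.
    by have [y yP] := ex s sc; exists y.
  by exists Y.
have [N] := ubnP (f s); elim: N s => // N IH s; rewrite ltnS => sN sc.
have [|Y YP] := @choice _ _ (fun t y =>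
    (t \in critical M) && (f t < f s)%N -> dual_cycle M t y).
  move=> t; have [/andP[tc ts]|] := boolP ((t \in critical M) && (f t < f s)%N); last by exists 0.
  by have [y yP] := IH t (leq_trans ts sN) tc; exists y.
have [z [zk zz z1 zsupp]] := zP s sc.
have ncr p : p \in M -> p.1 \in critical M = false.
  by move=> pM; apply/negbTE/criticalPn; exists p => //; left.
have ncr2 p : p \in M -> p.2 \in critical M = false.
  by move=> pM; apply/negbTE/criticalPn; exists p => //; right.
(* The support condition leaves [z] no lower cell at level [f s] or above, so the reduction does not
   change these levels. *)
have [|e [ek el eN]] := reduce_lower (N := f s) mM rhoP fP zk.
  move=> p pM Np; apply/eqP; apply: contraT => /zsupp/(_ Np) [e|[q qM e]].
    by rewrite -e ncr in sc.
  by have := matching_lower_upper mM pM qM; rewrite e eqxx.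
set z' := z - bd e in el.
have z'k : is_chain dim (dim s) z' by rewrite is_chainB // bd_chain.
have z'E x : (f s <= f x)%N -> z' x = z x by move=> sx; rewrite ffun_subE eN ?subr0.
pose Q t := (t \in critical M) && (f t < f s)%N.
(* The dual cycles found so far remove the critical cells below level [f s]; at or above it [s] is
   the only critical cell, and the sign [z s] normalises its coefficient to 1. *)
exists ((z' - \sum_(t | Q t) Y t *~ z' t) *~ z s); split.
- apply/is_chain_mulz/is_chainB => //; apply: is_chain_sum => t tQ.
  have [->|/(is_chainP _ _ _ z'k) <-] := eqVneq (z' t) 0; first by rewrite mulr0z is_chain0.
  by apply: is_chain_mulz; have [] := YP t tQ.
- rewrite raddfMz raddfB /= [bd (\sum_(t | _) _)]bd_sum_mulrz ?subr0; last by move=> t /YP[].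
  by rewrite raddfB /= zz bd_bd subr0 mul0rz.
- move=> p pM; rewrite ffun_mulrz ffun_subE el // sum_mulrzE big1 ?subrr ?mul0r //.
  by move=> t /YP[_ _ yl _]; rewrite yl // mul0r.
- move=> u uc; rewrite ffun_mulrz ffun_subE sum_mulrzE.
  rewrite (eq_bigr (fun t => (u == t)%:R * z' t)); last by move=> t /YP[_ _ _ ->].
  have [us|us] := leqP (f s) (f u).
    rewrite big1 ?subr0; last first.
      move=> t /andP[tc ts]; have [e1|] := eqVneq u t; last by rewrite mul0r.
      by move: ts; rewrite -e1 ltnNge us.
    have [->|ns] := eqVneq u s; first by rewrite z'E // z1.
    rewrite z'E //; have [->|/zsupp/(_ us)[e1|[p pM e1]]] := eqVneq (z u) 0; first by rewrite mul0r.
      by rewrite e1 eqxx in ns.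
    by rewrite e1 ncr2 in uc.
  rewrite (bigD1 u) /=; last by rewrite /Q uc.
  rewrite eqxx mul1r big1 ?addr0 ?subrr ?mul0r.
    by have [e1|//] := eqVneq u s; move: us; rewrite e1 ltnn.
  by move=> t /andP[_ tu]; rewrite eq_sym (negbTE tu) mul0r.
Qed.

Lemma filtration0 M : filtration M (fun _ => 0%N).
Proof. by []. Qed.

Lemma reduce_lower0 M rho k c :
    matching M -> decreasing_potential M rho -> is_chain dim k c ->
  exists2 e, is_chain dim k.+1 e & lower_free M (c - bd e).
Proof.
move=> mM rhoP ck.
have [//|e [ek el _]] := reduce_lower (N := 1) mM rhoP (filtration0 M) ck.
by exists e.
Qed.

Section DualBasis.
Variables (M : {set P * P}) (rho : P * P -> nat) (Y : P -> {ffun P -> int}).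
Hypothesis mM : matching M.
Hypothesis rhoP : decreasing_potential M rho.
Hypothesis YP : forall s, s \in critical M -> dual_cycle M s (Y s).

(** The difference of the two sides has neither critical nor lower cells and its boundary is
    lower-free, so [upper_chain_eq0] applies. *)
Lemma dual_expansion c : lower_free M c -> lower_free M (bd c) ->
  c = \sum_(t in critical M) Y t *~ c t.
Proof.
move=> cl bcl; apply/eqP; rewrite -subr_eq0; apply/eqP.
apply: (upper_chain_eq0 mM rhoP) => [x|p pM]; last first.
  rewrite raddfB /= ffun_subE bcl // [bd (\sum_(t | _) _)]bd_sum_mulrz ?ffunE ?subrr //.
  by move=> t /YP[].
rewrite ffun_subE sum_mulrzE.
have [xc|/criticalPn[p pM [e|e]]] := boolP (x \in critical M); last 1 first.
- by exists p.
- rewrite (bigD1 x) //= big1 ?addr0.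
    by have [_ _ _ ->] := YP xc; rewrite ?eqxx ?mul1r ?subrr ?eqxx.
  move=> t /andP[tc tx]; have [_ _ _ ->//] := YP tc.
  by rewrite eq_sym (negbTE tx) mul0r.
rewrite e cl // sub0r big1 ?oppr0 ?eqxx // => t /YP[_ _ yl _].
by rewrite yl // mul0r.
Qed.

(** Clearing the lower cells of [e] keeps its boundary and leaves a combination of cycles. This
    makes the dual cycles independent modulo boundaries. *)
Lemma lower_free_boundary k e :
  is_chain dim k e -> lower_free M (bd e) -> bd e = 0.
Proof.
move=> ek bl; have [g _ gl] := reduce_lower0 mM rhoP ek.
have bE : bd (e - bd g) = bd e by rewrite raddfB /= bd_bd subr0.
rewrite -bE (dual_expansion gl) ?bE // bd_sum_mulrz // => t /YP[] //.
Qed.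

Section FreeHomology.
Variable k : nat.
Let r := #|critical_dim dim M k|.

Definition dual_comb (v : 'rV[int]_r) : {ffun P -> int} :=
  \sum_(j < r) Y (enum_val j) *~ v 0 j.

Lemma critical_dim_critical (j : 'I_r) :
  enum_val j \in critical M /\ dim (enum_val j) = k.
Proof. by have := enum_valP j; rewrite inE => /andP[-> /eqP ->]. Qed.

Lemma dual_comb_cycle v : dual_comb v \in is_cycle dim inc k.
Proof.
rewrite unfold_in bd_sum_mulrz ?eqxx ?andbT.
  apply: is_chain_sum => j _; apply: is_chain_mulz.
  by have [jc jk] := critical_dim_critical j; have [] := YP jc; rewrite jk.
by move=> j _; have [/YP[]] := critical_dim_critical j.
Qed.

Lemma dual_comb_lower_free v : lower_free M (dual_comb v).
Proof.
move=> p pM; rewrite sum_mulrzE big1 // => j _.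
by have [/YP[_ _ -> //]] := critical_dim_critical j; rewrite mul0r.
Qed.

Lemma dual_combE v j : dual_comb v (enum_val j) = v 0 j.
Proof.
have [jc _] := critical_dim_critical j.
rewrite sum_mulrzE (bigD1 j) //= big1 ?addr0.
  by have [_ _ _ ->//] := YP jc; rewrite eqxx mul1r.
move=> t tj; have [/YP[_ _ _ ->//]] := critical_dim_critical t.
by rewrite (inj_eq enum_val_inj) eq_sym (negbTE tj) mul0r.
Qed.

Lemma dual_combB u v : dual_comb (u - v) = dual_comb u - dual_comb v.
Proof.
rewrite -sumrB; apply: eq_bigr => j _.
by rewrite !mxE -mulrzBr.
Qed.

Lemma dual_comb_boundary v e :
  is_chain dim k.+1 e -> bd e = dual_comb v -> v = 0.
Proof.
move=> ek be; have := lower_free_boundary ek.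
rewrite be => /(_ (@dual_comb_lower_free v)) z0.
by apply/rowP => j; rewrite -dual_combE z0 mxE ffunE.
Qed.

Lemma dual_comb_generates c : is_cycle dim inc k c ->
  exists v, exists2 e, is_chain dim k.+1 e & c = dual_comb v + bd e.
Proof.
move=> /andP[ck /eqP bc]; have [e ek el] := reduce_lower0 mM rhoP ck.
set c' := c - bd e in el.
have c'k : is_chain dim k c' by rewrite is_chainB // bd_chain.
exists (\row_j c' (enum_val j)), e => //.
rewrite -[LHS](subrK (bd e)) -/c'; congr (_ + _).
rewrite [LHS]dual_expansion //; last first.
  by move=> p _; rewrite raddfB /= bc bd_bd subrr ffunE.
rewrite (bigID (fun t => dim t == k)) /= [X in _ + X]big1 ?addr0.
  rewrite (eq_bigl (fun t => t \in critical_dim dim M k)).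
    by rewrite big_enum_val; apply: eq_bigr => j _; rewrite mxE.
  by move=> t; rewrite [RHS]inE.
move=> t /andP[_ tk]; suff -> : c' t = 0 by rewrite mulr0z.
by apply/eqP; apply: contraNT tk => /(is_chainP _ _ _ c'k) ->.
Qed.

(** The dual cycles form a basis. As the required map goes out of homology, it is chosen as a right
    inverse of [g] and inherits additivity through the injectivity of [g]. *)
Lemma homology_free : free_of_rank (homology dim inc k) r.
Proof.
pose G v : cycles dim inc k := Cycle (dual_comb_cycle v).
pose Q := Quotient.quot (@is_boundary P dim inc k).
pose g v : homology dim inc k := \pi_Q (G v).
have GB u v : G (u - v) = G u - G v by apply: val_inj; rewrite /= dual_combB.
have gB u v : g (u - v) = g u - g v by rewrite /g GB !piE.
have g0 v : g v = 0 -> v = 0.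
  move=> e; have /asboolP[c ck cv] : G v \in @is_boundary P dim inc k.
    by rewrite -[G v]subr0 Quotient.idealrBE; apply/eqP; rewrite [LHS]e !piE.
  exact: dual_comb_boundary cv.
have gsurj h : exists v, g v = h.
  elim/quotW: h => z; have [v [e ek ze]] := dual_comb_generates (valP z).
  exists v; apply/eqP; rewrite -Quotient.idealrBE; apply/asboolP.
  exists (- e); first by rewrite -sub0r is_chainB ?is_chain0.
  by rewrite raddfN /= ze opprD addrA subrr sub0r.
have [f fK] := choice gsurj.
have ginj u v : g u = g v -> u = v.
  by move=> e; apply/eqP; rewrite -subr_eq0; apply/eqP/g0; rewrite gB e subrr.
have fB : {morph f : h h' / h - h'} by move=> h h'; apply: ginj; rewrite gB !fK.
pose F : {additive homology dim inc k -> 'rV[int]_r} :=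
  HB.pack f (GRing.isZmodMorphism.Build _ _ f fB).
by exists F, g => [h|v]; [exact: fK | apply: ginj; rewrite fK].
Qed.

End FreeHomology.
End DualBasis.

(* An integral relation between the reductions of the dual cycles modulo M'
   would bound a nonzero combination of dual cycles. *)
Lemma critical_card_le M rho Y M' rho' k :
    matching M -> decreasing_potential M rho ->
    (forall s, s \in critical M -> dual_cycle M s (Y s)) ->
    matching M' -> decreasing_potential M' rho' ->
  (#|critical_dim dim M k| <= #|critical_dim dim M' k|)%N.
Proof.
move=> mM rhoP YP mM' rhoP'; rewrite leqNgt; apply/negP => lt.
pose y (j : 'I_#|critical_dim dim M k|) := Y (enum_val j).
have yP j : is_chain dim k (y j) /\ bd (y j) = 0.
  have [jc jk] := critical_dim_critical j.
  by have [] := YP _ jc; rewrite jk.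
have [|e eP] := @choice _ _ (fun j g =>
    is_chain dim k.+1 g /\ lower_free M' (y j - bd g)).
  move=> j; have [g gk gl] := reduce_lower0 mM' rhoP' (yP j).1.
  by exists g.
pose x j := y j - bd (e j).
have xk j : is_chain dim k (x j).
  by rewrite is_chainB ?(yP j).1 // bd_chain // (eP j).1.
pose A : 'M[int]_(#|critical_dim dim M k|, #|critical_dim dim M' k|) :=
  \matrix_(j, c) x j (enum_val c).
have [v v0 vA] := int_kernel A lt.
(* This combination is a cycle, lower-free for [M'], and [v] kills its critical coefficients; being
   supported on upper cells, it vanishes. *)
suff W0 : \sum_j x j *~ v 0 j = 0.
  move/eqP: v0; apply.
  apply: (dual_comb_boundary mM rhoP YP (e := \sum_j e j *~ v 0 j)).
    by apply: is_chain_sum => j _; apply/is_chain_mulz/(eP j).1.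
  apply/eqP; rewrite eq_sym -subr_eq0; apply/eqP; rewrite -[RHS]W0 [bd _]raddf_sum -sumrB.
  by apply: eq_bigr => j _; rewrite raddfMz /= -mulrzBl.
apply: (upper_chain_eq0 mM' rhoP') => [z|p pM]; last first.
  rewrite bd_sum_mulrz ?ffunE // => j _.
  by rewrite raddfB /= (yP j).2 bd_bd subrr.
have [zc|/criticalPn[p pM [ez|ez]]] := boolP (z \in critical M'); last 1 first.
- by exists p.
- move=> Wz; have zk : dim z = k.
    apply: (is_chainP _ _ _ _ z Wz); apply: is_chain_sum => j _.
    exact/is_chain_mulz/xk.
  have zk' : z \in critical_dim dim M' k by rewrite inE zc zk eqxx.
  move: Wz; rewrite -(enum_rankK_in zk' zk') sum_mulrzE.
  set c := enum_rank_in _ _.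
  have /rowP/(_ c) := vA; rewrite !mxE => e0.
  rewrite (eq_bigr (fun j => v 0 j * A j c)) ?e0 ?eqxx //.
  by move=> j _; rewrite mxE mulrC.
rewrite ez sum_mulrzE big1 ?eqxx // => j _.
by rewrite [x j _](eP j).2 ?mul0r.
Qed.

(** * Sums over alternating paths *)

Section MorseIncidence.
Variables (M : {set P * P}) (rho : P * P -> nat).
Hypothesis mM : matching M.
Hypothesis rhoP : decreasing_potential M rho.

(** Signed weights summed over walks that only avoid returning at once to the upper cell they come
    from. This local condition permits a recursion, and by acyclicity it already forces all pairs to
    be distinct. *)
Fixpoint walk_sum m (v t : P) : int :=
  if m is m'.+1 then
    - \sum_(p in M | p.2 != v) inc v p.1 * inc p.2 p.1 * walk_sum m' p.2 t
  else inc v t.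

Lemma alternating_path_cons v t p r :
  alternating_path M v t (p :: r) =
  [&& p \in M, covered p.1 v, p \notin r & alternating_path M p.2 t r].
Proof.
rewrite /alternating_path /=; apply/and3P/and4P.
  by move=> [/andP[-> ->] /andP[-> ->] /andP[-> ->]].
by move=> [pM -> -> /and3P[-> -> ->]]; rewrite andbT; split.
Qed.

Lemma alternating_path_sub v t r :
  alternating_path M v t r -> {subset r <= M}.
Proof. by move=> /and3P[/allP]. Qed.

Lemma upper_notin r p : {subset r <= M} -> p \in M ->
  (p.2 \in [seq q.2 | q <- r]) = (p \in r).
Proof.
move=> rM pM; apply/mapP/idP => [[q qr e]|pr]; last by exists p.
by rewrite (matching_inj2 mM pM (rM _ qr) e).
Qed.

Lemma alternating_path_decreasing p t r : p \in M ->
  alternating_path M p.2 t r -> p \notin r ->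
  forall q, q \in r -> (rho q < rho p)%N.
Proof.
elim: r p => //= p' r IH p pM; rewrite alternating_path_cons.
move=> /and4P[p'M cov p'r ap]; rewrite inE negb_or => /andP[pp' pr] q.
have lt := rhoP pM p'M pp' cov.
by rewrite inE => /predU1P[->//|/(IH _ p'M ap p'r) /ltn_trans]; apply.
Qed.

(** If [v] were the upper cell of a later pair [q], then [p.1] being a facet of [v] would give
    [rho p < rho q], while the potential decreases along the path. So the global condition on [v]
    reduces to [p.2 != v]. *)
Lemma walk_path_cons v t p r :
  alternating_path M v t (p :: r) && (v \notin [seq q.2 | q <- p :: r]) =
  [&& p \in M, p.2 != v & covered p.1 v] &&
  (alternating_path M p.2 t r && (p.2 \notin [seq q.2 | q <- r])).
Proof.
rewrite alternating_path_cons /= inE negb_or [v == _]eq_sym.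
have [pM|//] := boolP (p \in M).
have [cov|] := boolP (covered p.1 v); last by rewrite /= !andbF.
have [ap|] := boolP (alternating_path M p.2 t r); last by rewrite /= !andbF.
rewrite (upper_notin (alternating_path_sub ap)) //=.
have [pr|pr] := boolP (p \in r); rewrite ?andbF ?andbT //=.
have [pv|pv] //= := boolP (p.2 != v).
apply/mapP => -[q qr e]; have qM := alternating_path_sub ap qr.
have qp : q != p by apply: contraNneq pv => <-; rewrite e.
rewrite e in cov; have := rhoP qM pM qp cov.
by rewrite ltnNge ltnW // (alternating_path_decreasing pM ap).
Qed.

Lemma path_weight_cons v t p r :
  path_weight inc v t (p :: r) =
  - (inc v p.1 * inc p.2 p.1 * path_weight inc p.2 t r).
Proof. by rewrite /path_weight /= !big_cons /= exprS; ring. Qed.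

Lemma walk_sumE m v t :
  \sum_(r : m.-tuple (P * P) |
      alternating_path M v t r && (v \notin [seq q.2 | q <- r]))
    path_weight inc v t r = walk_sum m v t.
Proof.
elim: m v => [|m IH] v /=.
  rewrite (eq_bigl (fun r => (r == [tuple]) && covered t v)); last first.
    by move=> r; rewrite (tuple0 r) eqxx /alternating_path /= !andbT.
  have [cov|] := boolP (covered t v); last first.
    move=> /(contraNeq (inc_covered (x := t) (y := v))) ->.
    by rewrite big_pred0 // => r; rewrite andbF.
  rewrite (eq_bigl (pred1 [tuple])); last by move=> r; rewrite andbT.
  by rewrite big_pred1_eq /path_weight big_nil big_seq1 !mul1r.
rewrite (reindex (fun z : (P * P) * m.-tuple (P * P) => cons_tuple z.1 z.2)) /=; last first.
  exists (fun r => (thead r, behead_tuple r)) => [[p r] _|r _] /=.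
    by rewrite theadE; congr (_, _); apply: val_inj.
  by rewrite [RHS]tuple_eta; apply: val_inj.
rewrite (eq_bigl _ _ (fun z : P * P * m.-tuple (P * P) => walk_path_cons v t z.1 z.2)).
rewrite -(pair_big_dep (fun p => [&& p \in M, p.2 != v & covered p.1 v])
  (fun p (r : m.-tuple (P * P)) =>
     alternating_path M p.2 t r && (p.2 \notin [seq q.2 | q <- r]))
  (fun p r => path_weight inc v t (p :: r))) /=.
rewrite -sumrN [RHS](bigID (fun p => covered p.1 v)) /= [X in _ = _ + X]big1 ?addr0.
  apply: eq_big => [p|p _]; first by rewrite -andbA.
  by rewrite -IH mulr_sumr -sumrN; apply: eq_bigr => r _; rewrite path_weight_cons.
move=> p /andP[_ ncov].
rewrite (_ : inc v p.1 = 0) ?mul0r ?oppr0 //.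
by apply/eqP; apply: contraNT ncov => /inc_covered.
Qed.

(** Together with [q] such a walk would list more distinct pairs than [M] has. *)
Lemma walk_sum_long q t : q \in M -> walk_sum #|M| q.2 t = 0.
Proof.
move=> qM; rewrite -walk_sumE big_pred0 // => r; apply/negP => /andP[ap qr].
have rM := alternating_path_sub ap.
rewrite (upper_notin rM qM) in qr.
have /and3P[_ ur _] := ap.
have /uniq_leq_size : uniq (q :: r) by rewrite /= qr.
move=> /(_ (enum M)); rewrite -cardE /= size_tuple ltnn => h.
suff : false by []; apply: h => x; rewrite inE mem_enum => /predU1P[->//|]; exact: rM.
Qed.

Lemma dual_cycle_sum s y (F : P -> int) : s \in critical M -> dual_cycle M s y ->
  \sum_v y v * F v = F s + \sum_(p in M) y p.2 * F p.2.
Proof.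
move=> sc [_ _ yl yc]; rewrite (partition_big (fun p => p.2) predT) //=.
have {1}-> : F s = \sum_v (v == s)%:R * F v.
  rewrite (bigD1 s) //= eqxx mul1r big1 ?addr0 // => v vs.
  by rewrite (negbTE vs) mul0r.
rewrite -big_split; apply: eq_bigr => v _ /=.
have [vc|/criticalPn[p pM [e|e]]] := boolP (v \in critical M).
- rewrite yc // big_pred0 ?addr0 // => p; apply/negP => /andP[pM /eqP e].
  by move: vc; rewrite -e; apply/negP/criticalPn; exists p => //; right.
- rewrite e yl // mul0r big_pred0 ?addr0 => [|q].
    rewrite (_ : (p.1 == s) = false) ?mul0r //; apply/eqP => e1.
    by move: sc; apply/negP/criticalPn; exists p => //; left.
  apply/negP => /andP[qM]; rewrite eq_sym; apply/negP.
  exact: (matching_lower_upper mM pM qM).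
- rewrite (_ : (v == s) = false) ?mul0r ?add0r; last first.
    apply/eqP => e1; move: sc; apply/negP/criticalPn; exists p => //; right.
    by rewrite -e.
  rewrite (big_pred1 p) ?e // => q; apply/andP/eqP => [[qM /eqP]|->//].
  exact: (matching_inj2 mM).
Qed.

(* Solving bd y = 0 at the lower cells expresses the coefficients of y on the
   upper cells as sums over alternating paths; at t it becomes the Morse
   incidence number. *)
Lemma dual_cycle_incidence s y t : s \in critical M -> dual_cycle M s y ->
  morse_incidence inc M s t = 0.
Proof.
move=> sc yP; have [_ yb _ _] := yP.
have bdE x : inc s x + \sum_(q in M) y q.2 * inc q.2 x = 0.
  rewrite -(dual_cycle_sum (fun v => inc v x) sc yP).
  by have /ffunP/(_ x) := yb; rewrite !ffunE.
have sU p : p \in M -> p.2 != s.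
  by move=> pM; apply: contraTneq sc => <-; apply/criticalPn; exists p => //; right.
(* The remainder after [m] substitutions of the equation [bd y = 0] into itself; each further one
   splits off the walks from [s] with one more pair. *)
pose rest m := \sum_(q in M) y q.2 * walk_sum m q.2 t.
have restS m : rest m = walk_sum m.+1 s t + rest m.+1.
  rewrite /rest /= (eq_bigr (fun p => - (inc s p.1 * inc p.2 p.1 * walk_sum m p.2 t)
     + \sum_(q in M | p != q) y q.2 * - (inc q.2 p.1 * inc p.2 p.1 * walk_sum m p.2 t))).
    rewrite big_split /= sumrN; congr (- _ + _).
      by apply: eq_bigl => p; case: (boolP (p \in M)) => // /sU ->.
    rewrite (exchange_big_dep (fun q => q \in M)) /=; last by move=> ? ? _ /andP[].
    apply: eq_bigr => q qM; rewrite -sumrN mulr_sumr; apply: eq_bigl => p.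
    case: (boolP (p \in M)) => //= pM; rewrite qM /=; congr (~~ _).
    by apply/eqP/eqP => [->//|]; apply: (matching_inj2 mM).
  move=> p pM; have := bdE p.1; rewrite (bigD1 p) //= => e.
  have i1 := inc_sqr (mM.1 p pM).
  rewrite (eq_bigr (fun q => y q.2 * inc q.2 p.1 * - (inc p.2 p.1 * walk_sum m p.2 t))); last first.
    by move=> q _; ring.
  rewrite -mulr_suml (eq_bigl (fun q => (q \in M) && (q != p))); last first.
    by move=> q; rewrite [p == q]eq_sym.
  set S := \sum_(q in M | q != p) _ in e *.
  have -> : S = - inc s p.1 - y p.2 * inc p.2 p.1.
    by apply/eqP; rewrite -subr_eq0 -e; apply/eqP; ring.
  by rewrite -[LHS]mul1r -i1; ring.
have partial m : \sum_(j < m.+1) walk_sum j s t + rest m = 0.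
  elim: m => [|m IH]; first by rewrite big_ord_recl big_ord0 addr0 /rest /= bdE.
  by rewrite big_ord_recr /= -addrA -restS.
have := partial #|M|; rewrite [rest _]big1 ?addr0; last first.
  by move=> q qM; rewrite walk_sum_long ?mulr0.
move=> <-; apply: eq_bigr => j _; rewrite -walk_sumE; apply: eq_bigl => r.
have [ap|//] := boolP (alternating_path M s t r); symmetry.
apply/mapP => -[p /(alternating_path_sub ap) pM e].
by move: (sU p pM); rewrite e eqxx.
Qed.

End MorseIncidence.

End Morse.

(** * Runs of descents *)

Section RunDecomposition.
Implicit Types (bs : seq bool) (s : seq (nat * nat)) (p q : nat * nat).

(** Positions start at 1; the padding makes the position before a run starting at 1 a
    non-descent. *)
Definition bit bs (j : nat) : bool := nth false (false :: bs) j.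

(** Greedy scan for triples x > b > a: two [true] are the descents of a triple, and the next bit,
    comparing a with its successor, is skipped whatever it is. A run fails exactly when its length
    is 1 modulo 3, leaving a lone [true]; the result counts the triples. *)
Fixpoint parse_bits bs : option nat :=
  match bs with
  | [::] => Some 0%N
  | false :: bs' => parse_bits bs'
  | true :: true :: bs' =>
      omap S (if bs' is _ :: bs'' then parse_bits bs'' else Some 0%N)
  | _ => None
  end.

Definition runs s : seq nat := flatten [seq iota p.1 p.2.+1 | p <- s].

Lemma runs_cons p s : runs (p :: s) = iota p.1 p.2.+1 ++ runs s.
Proof. by []. Qed.

Lemma mem_runs s j :
  reflect (exists2 p : nat * nat, p \in s & (p.1 <= j <= p.1 + p.2)%N) (j \in runs s).
Proof.
apply: (iffP flatten_mapP) => -[p ps]; rewrite ?mem_iota => h; exists p => //.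
  by rewrite addnS ltnS in h.
by rewrite mem_iota addnS ltnS.
Qed.

Lemma parse_bits3 bs : parse_bits [:: true, true & bs] = omap S (parse_bits (behead bs)).
Proof. by case: bs. Qed.

Lemma runs_disjoint s p q j : uniq (runs s) -> p \in s -> q \in s ->
  (p.1 <= j <= p.1 + p.2)%N -> (q.1 <= j <= q.1 + q.2)%N -> p = q.
Proof.
move=> us ps qs pj qj; apply/eqP; apply: contraT => pq.
elim: s us ps qs => // r s IH; rewrite runs_cons cat_uniq => /and3P[u1 u2 u3].
have dis (p' : nat * nat) : p' \in s -> (p'.1 <= j <= p'.1 + p'.2)%N ->
    (r.1 <= j <= r.1 + r.2)%N -> False.
  move=> p's p'j rj; move/hasPn: u2 => /(_ j).
  have -> : j \in runs s by apply/mem_runs; exists p'.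
  by move=> /(_ isT); rewrite mem_iota addnS ltnS rj.
rewrite !inE => /predU1P[e1|ps] /predU1P[e2|qs].
- by rewrite e1 e2 eqxx in pq.
- by case: (dis q qs qj); rewrite -e1.
- by case: (dis p ps pj); rewrite -e2.
- exact: IH.
Qed.

Lemma runs_uniq s : uniq (runs s) -> uniq s.
Proof.
elim: s => // r s IH; rewrite runs_cons cat_uniq => /and3P[u1 u2 u3].
rewrite /= IH // andbT; apply/negP => rs; move/hasPn: u2 => /(_ r.1).
have -> : r.1 \in runs s.
  by apply/mem_runs; exists r; rewrite // leqnn leq_addr.
by move=> /(_ isT); rewrite inE eqxx.
Qed.

(* Scanning from k, the runs still ahead contribute their whole weight and a run
   entered at an offset divisible by 3 the weight of its remainder. *)
Lemma run_decomposition_parse D bs s :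
    (forall j, (j \in D) = bit bs j) -> run_decomposition D s ->
  parse_bits bs = Some (\sum_(p <- s) ceil_div3 p.2)%N.
Proof.
move=> Dbs [us Dr qP0 nP0].
have qP (p : nat * nat) : p \in s -> exists j, (p.2 = 3 * j + 1 \/ p.2 = 3 * j + 2)%N.
  exact: qP0.
have nP (p : nat * nat) : p \in s -> p.1.-1 \notin D /\ (p.1 + p.2 + 1)%N \notin D.
  exact: nP0.
have bitr j : bit bs j = (j \in runs s) by rewrite -Dbs Dr.
have p1 (p : nat * nat) : p \in s -> (0 < p.1)%N.
  move=> ps; rewrite lt0n; apply/eqP => p0.
  have : bit bs 0 = false by [].
  rewrite bitr => /mem_runs; apply; exists p => //; rewrite p0.
  by rewrite leq0n.
have bitp (p : nat * nat) j : p \in s -> (p.1 <= j <= p.1 + p.2)%N -> bit bs j.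
  by move=> ps pj; rewrite bitr; apply/mem_runs; exists p.
pose fresh k := forall p : nat * nat, p \in s ->
  [\/ (k.+1 <= p.1)%N, (p.1 + p.2 <= k)%N | exists o, (k.+1 = p.1 + 3 * o)%N].
(* Truncated subtraction covers all cases: a run ahead keeps [p.2], a run entered keeps its
   remainder, and a run left behind gives [ceil_div3 0 = 0]. *)
suff main N k : (size bs - k <= N)%N -> fresh k ->
    parse_bits (drop k bs) = Some (\sum_(p <- s) ceil_div3 (p.2 - (k.+1 - p.1)))%N.
  rewrite -[bs in LHS]drop0 (main (size bs)) ?subn0 //.
    congr (Some _); apply: eq_big_seq; move=> p; move: (p : nat * nat) => {}p.
    by move=> /p1 p0; congr (ceil_div3 _); lia.
  by move=> p /p1 p0; apply: Or31.
elim: N k => [|N IH] k kN fk.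
  rewrite drop_oversize ?big1_seq //=; last by lia.
  move=> p; move: (p : nat * nat) => {}p ps; rewrite (_ : (_ - _)%N = 0%N) //.
  suff : (p.1 + p.2 <= size bs)%N by lia.
  rewrite leqNgt; apply/negP => lt.
  have := bitp p (p.1 + p.2)%N ps; rewrite leq_addr leqnn => /(_ isT).
  by rewrite /bit nth_default.
have [lt|ge] := ltnP k (size bs); last by apply: IH => //; lia.
rewrite (drop_nth false lt).
have bk : nth false bs k = bit bs k.+1 by [].
case bE : (nth false bs k); last first.
  rewrite [parse_bits _]/= IH; first last.
  - move=> p ps; have [h|h|[o h]] := fk p ps; [|by apply: Or32; lia|].
      have [e|ne] := eqVneq p.1 k.+1; last by apply: Or31; lia.
      by have := bitp p k.+1 ps; rewrite e leqnn leq_addr -bk bE => /(_ isT).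
    have [le|gt] := leqP k.+1 (p.1 + p.2); last by apply: Or32; lia.
    by have := bitp p k.+1 ps; rewrite le andbT -bk bE h leq_addr => /(_ isT).
  - by lia.
  congr (Some _); apply: eq_big_seq => p; move: (p : nat * nat) => {}p ps.
  congr (ceil_div3 _).
  have nb : ~ (p.1 <= k.+1 <= p.1 + p.2)%N.
    by move=> h; have := bitp p _ ps h; rewrite -bk bE.
  lia.
have /mem_runs[p0 p0s p0k] : k.+1 \in runs s by rewrite -bitr -bk bE.
have [o ko] : exists o, (k.+1 = p0.1 + 3 * o)%N.
  have [h|h|//] := fk p0 p0s; last by exfalso; lia.
  by exists 0%N; lia.
(* As [p0.2] is not divisible by 3, the run does not end at an offset divisible by 3. *)
have p0k2 : (k.+2 <= p0.1 + p0.2)%N by have [j [e|e]] := qP p0 p0s; lia.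
have b2 : bit bs k.+2 by apply: (bitp p0) => //; lia.
have lt2 : (k.+1 < size bs)%N.
  by rewrite ltnNge; apply/negP => ge; rewrite /bit nth_default in b2.
rewrite (drop_nth false lt2) (_ : nth false bs k.+1 = true) // parse_bits3.
rewrite -drop1 drop_drop add1n IH; first last.
- move=> p ps; have [->|pp0] := eqVneq p p0.
    by apply: Or33; exists o.+1; lia.
  have np1 : ~ (p.1 <= k.+1 <= p.1 + p.2)%N.
    by move=> h; move/eqP: pp0; apply; apply: (runs_disjoint us ps p0s h p0k).
  have [h|h] := leqP (p.1 + p.2) k.+3; first by apply: Or32.
  apply: Or31; rewrite ltnNge; apply/negP => h4.
  have [h5|h5] := leqP p.1 (p0.1 + p0.2).
    have : (p0.1 <= p.1)%N by lia.
    move=> h6; move/eqP: pp0; apply; apply: (runs_disjoint (j := p.1) us ps p0s); lia.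
  (* Here [p] would start right behind [p0], where the decomposition has a gap. *)
  have [_] := nP p0 p0s; rewrite Dbs; apply/negP; rewrite negbK.
  by apply: (bitp p) => //; lia.
- by lia.
rewrite /=; congr (Some _).
rewrite (bigD1_seq p0 p0s (runs_uniq us)) [in RHS](bigD1_seq p0 p0s (runs_uniq us)) /=.
rewrite -addSn; congr (_ + _)%N.
  by rewrite /ceil_div3; lia.
rewrite big_seq_cond [in RHS]big_seq_cond; apply: eq_bigr => p.
move: (p : nat * nat) => {}p /andP[ps pp0].
have np1 : ~ (p.1 <= k.+1 <= p.1 + p.2)%N.
  by move=> h; move/eqP: pp0; apply; apply: (runs_disjoint us ps p0s h p0k).
have [h|h] := leqP p.1 k.+1; first by congr (ceil_div3 _); lia.
congr (ceil_div3 _); suff : (k.+4 <= p.1)%N by lia.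
have [h5|h5] := leqP p.1 (p0.1 + p0.2).
  move/eqP: pp0 => []; apply: (runs_disjoint (j := p.1) us ps p0s); lia.
have [_] := nP p0 p0s; rewrite Dbs => nb.
suff : p.1 <> (p0.1 + p0.2 + 1)%N by lia.
by move=> e; move/negP: nb; apply; rewrite -e; apply: (bitp p) => //; lia.
Qed.

Definition shift_runs k s : seq (nat * nat) := [seq (k + p.1, p.2)%N | p : nat * nat <- s].

Lemma runs_shift k s : runs (shift_runs k s) = map (addn k) (runs s).
Proof.
elim: s => // p s IH.
by rewrite /shift_runs map_cons -/(shift_runs k s) !runs_cons IH map_cat -iotaDl.
Qed.

Definition bit_runs bs s : Prop :=
  [/\ uniq (runs s), forall j, bit bs j = (j \in runs s),
      (forall p : nat * nat, p \in s ->
         exists j, (p.2 = 3 * j + 1 \/ p.2 = 3 * j + 2)%N)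
    & forall p : nat * nat, p \in s ->
         ~~ bit bs p.1.-1 /\ ~~ bit bs (p.1 + p.2 + 1)].

Lemma bit_runs_gt0 bs s p : bit_runs bs s -> p \in s -> (0 < p.1)%N.
Proof.
move=> [_ br _ _] ps; rewrite lt0n; apply/eqP => p0.
have : bit bs 0 = false by [].
rewrite br => /mem_runs; apply; exists p => //; rewrite p0.
by rewrite leq0n.
Qed.

Lemma bit_runs_start bs s p : bit_runs bs s -> p \in s -> bit bs p.1.
Proof.
move=> [_ br _ _] ps; rewrite br; apply/mem_runs; exists p => //.
by rewrite leqnn leq_addr.
Qed.

Lemma bit_cat us bs j : bit (us ++ bs) (size us + j.+1) = bit bs j.+1.
Proof. by rewrite /bit addnS /= nth_cat ltnNge leq_addr /= addKn. Qed.

Lemma bit_shift_neighbours us bs s : bit_runs bs s ->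
    (bit bs 1 -> ~~ bit us (size us)) ->
  forall p : nat * nat, p \in shift_runs (size us) s ->
    ~~ bit (us ++ bs) p.1.-1 /\ ~~ bit (us ++ bs) (p.1 + p.2 + 1).
Proof.
move=> sP us1 _ /mapP[p ps ->] /=.
move: (p : nat * nat) ps => {}p ps.
have p0 := bit_runs_gt0 sP ps; have := bit_runs_start sP ps.
have [_ _ _ /(_ p ps) [n1 n2]] := sP => bp; split; last first.
  by rewrite -addnA -addnA addn1 addnS bit_cat -addn1.
case: p p0 n1 bp {ps n2} => [[//|[|m]] q] /= _ n1 bp; last first.
  by rewrite addnS /= bit_cat.
rewrite addn1 /=; move: (us1 bp); rewrite /bit.
by case e: (size us) => [|k] //=; rewrite nth_cat e ltnSn.
Qed.

Lemma shift_runs_mod3 k s :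
  (forall p : nat * nat, p \in s -> exists j, (p.2 = 3 * j + 1 \/ p.2 = 3 * j + 2)%N) ->
  forall p : nat * nat, p \in shift_runs k s ->
    exists j, (p.2 = 3 * j + 1 \/ p.2 = 3 * j + 2)%N.
Proof. by move=> h _ /mapP[p ps ->] /=; apply: h. Qed.

Lemma mem_shift k j (r : seq nat) : (k + j \in map (addn k) r) = (j \in r).
Proof. by rewrite mem_map //; apply: addnI. Qed.

Lemma mem_shift_small k j (r : seq nat) : (0 \notin r) -> (j <= k)%N ->
  (j \in map (addn k) r) = false.
Proof.
move=> r0 jk; apply/mapP => -[i ir e].
by case: i ir e => [ir|i _ e]; [rewrite ir in r0 | lia].
Qed.

(** The runs are rebuilt from the right. A triple opens a run with [q] equal to 1 or 2, unless its
    skipped bit and the bit after it are both set; then it is glued to the run that follows, and [q]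
    grows by 3. The last conclusion keeps a run starting at 1 at the head of the list, where gluing
    finds it. *)
Lemma parse_bit_runs bs : parse_bits bs <> None ->
  exists2 s, bit_runs bs s & bit bs 1 -> exists (q : nat) s', s = (1, q)%N :: s'.
Proof.
have [k] := ubnP (size bs); elim: k bs => // k IH [|[] bs] bk.
- move=> _; exists [::] => //; split=> // j.
  by rewrite /bit; case: j => //= j; rewrite nth_nil.
- case: bs bk => [//|[//|//]] bs bk; rewrite parse_bits3 => ok.
  case: bs ok bk => [_ _|b bs ok bk].
    exists [:: (1, 1)]%N; last by move=> _; exists 1%N, [::].
    split=> //; first by case=> [|[|[|j]]] //; rewrite /bit /= nth_nil.
      by move=> p; rewrite inE => /eqP->; exists 0%N; left.
    by move=> p; rewrite inE => /eqP->.
  have [||s sP sh] := IH bs; first by rewrite /= in bk; lia.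
    by move=> e; apply: ok; rewrite /= e.
  have [us br q3 nb] := sP.
  have r0 : 0%N \notin runs s by rewrite -br.
  pose us3 := [:: true; true; b].
  have [/andP[b1 bs1]|nbb] := boolP (b && bit bs 1).
    have [q [s' es]] := sh bs1.
    have rE : runs ((1, q.+3)%N :: shift_runs 3 s') = iota 1 3 ++ map (addn 3) (runs s).
      by rewrite es !runs_cons map_cat runs_shift catA -iotaDl.
    exists ((1, q.+3)%N :: shift_runs 3 s'); last by move=> _; exists q.+3, (shift_runs 3 s').
    split; rewrite ?rE.
    + rewrite cat_uniq map_inj_uniq ?us ?andbT /=; last by apply: addnI.
      apply/hasPn => _ /mapP[j jr ->]; rewrite !inE.
      by case: j jr => [jr|j _]; [rewrite jr in r0 | lia].
    + move=> j; rewrite mem_cat b1; case: j => [|[|[|[|j]]]] //.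
        by rewrite mem_shift_small.
      transitivity (bit bs j.+1); first by rewrite -(bit_cat [:: true; true; true]).
      by rewrite br (mem_shift 3 j.+1) mem_iota.
    + move=> p; rewrite inE => /predU1P[->|].
        have [j [e|e]] : exists j, (q = 3 * j + 1 \/ q = 3 * j + 2)%N.
          by apply: (q3 (1, q)%N); rewrite es mem_head.
        * by exists j.+1; left => /=; lia.
        * by exists j.+1; right => /=; lia.
      by apply: shift_runs_mod3 => p' p's; apply: q3; rewrite es inE p's orbT.
    + move=> p; rewrite inE => /predU1P[->|/mapP[p' p's ->]].
        split=> //=; rewrite -[[:: true, true, b & bs]]/(us3 ++ bs).
        rewrite (_ : 1 + q.+3 + 1 = size us3 + q.+2)%N ?bit_cat; last by rewrite /=; lia.
        have qs : (1, q)%N \in s by rewrite es mem_head.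
        by have [_] := nb _ qs; rewrite add1n addn1.
      have p's2 : p' \in s by rewrite es inE p's orbT.
      have [n1 n2] := nb p' p's2; have p0 := bit_runs_gt0 sP p's2.
      split; last first.
        rewrite (_ : bit _ _ = bit (us3 ++ bs) (size us3 + (p'.1 + p'.2).+1)).
          by rewrite bit_cat -addn1.
        by rewrite addn1.
      case: p' p's {p's2 n2} p0 n1 => [[//|[|m]] q'] p's /= _ n1.
        move: us; rewrite es runs_cons cat_uniq => /and3P[_ /hasPn/(_ 1%N)].
        rewrite mem_iota /= => h _; suff : false by []; apply: h.
        by apply/mem_runs; exists (1, q')%N => //=; lia.
      by rewrite (_ : bit _ _ = bit (us3 ++ bs) (size us3 + m.+1)) ?bit_cat.
  exists ((1, 1 + b)%N :: shift_runs 3 s); last by move=> _; exists (1 + b)%N, (shift_runs 3 s).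
  have rE : runs ((1, 1 + b)%N :: shift_runs 3 s) = iota 1 (2 + b) ++ map (addn 3) (runs s).
    by rewrite runs_cons runs_shift.
  split; rewrite ?rE.
  + rewrite cat_uniq map_inj_uniq ?us ?iota_uniq ?andbT /=; last by apply: addnI.
    apply/hasPn => _ /mapP[j jr ->]; rewrite !inE mem_iota.
    by case: j jr => [jr|j _]; [rewrite jr in r0 | case: (b) => /=; lia].
  + move=> j; rewrite mem_cat; case: j => [|[|[|[|j]]]] //.
    * by rewrite mem_shift_small // mem_iota.
    * by rewrite mem_shift_small // mem_iota orbF; case: (b).
    * transitivity (bit bs j.+1); first by rewrite -(bit_cat us3).
      rewrite br (mem_shift 3 j.+1) mem_iota orbC; case: (j.+1 \in runs s) => //=.
      by case: (b) => /=; lia.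
  + move=> p; rewrite inE => /predU1P[->|]; last exact: shift_runs_mod3.
    by exists 0%N; case: (b) => /=; [right|left].
  + move=> p; rewrite inE => /predU1P[->|].
      by split=> //=; move: nbb; case: (b).
    rewrite -[[:: true, true, b & bs]]/(us3 ++ bs).
    apply: (@bit_shift_neighbours us3 bs s sP) => bs1.
    by move: nbb; rewrite bs1 andbT.
- rewrite [parse_bits _]/= => ok.
  have [||s sP sh] := IH bs => //.
  have [us br q3 nb] := sP.
  have r0 : 0%N \notin runs s by rewrite -br.
  exists (shift_runs 1 s) => //; split; rewrite ?runs_shift.
  + by rewrite map_inj_uniq //; apply: addnI.
  + move=> [|j]; first by rewrite mem_shift_small.
    by rewrite (mem_shift 1 j) -br; case: j => // j; rewrite -(bit_cat [:: false]).
  + exact: shift_runs_mod3.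
  + exact: (@bit_shift_neighbours [:: false] bs s sP).
Qed.

Lemma parse_run_decomposition D bs :
    (forall j, (j \in D) = bit bs j) ->
  parse_bits bs <> None -> exists s, run_decomposition D s.
Proof.
move=> Dbs /parse_bit_runs[s [us br q3 nb] _]; exists s; split=> //.
- by move=> j; rewrite Dbs br.
- by move=> p ps; rewrite !Dbs; apply: nb.
Qed.

End RunDecomposition.

(** * Words with unordered pairs *)

Section BlockLists.
Variable n : nat.

(* A block is a letter [inl x] or a pair [inr (b, a)], with a < b, standing for
   the two letters a and b in either order. *)
Definition block : Type := ('I_n + 'I_n * 'I_n)%type.
Implicit Types (l m u v : seq block) (x y a b : 'I_n) (c : seq block -> int).

Definition letters (z : block) : seq 'I_n :=
  match z with inl x => [:: x] | inr (b, a) => [:: b; a] end.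

Definition flat l : seq 'I_n := flatten (map letters l).

Definition is_pair (z : block) : bool := if z is inr _ then true else false.

Definition npairs l : nat := count is_pair l.

Definition valid l : bool :=
  all (fun z : block => if z is inr (b, a) then (a < b)%N else true) l.

Definition mkpair a b : block := if (a < b)%N then inr (b, a) else inr (a, b).

Definition order_sign a b : int :=
  if (b < a)%N then 1 else if (a < b)%N then -1 else 0.

Definition block_sign (z : block) : int := if is_pair z then -1 else 1.

(** Chains are functions on lists, so a boundary is evaluated at the face: adjacent letters of the
    face are merged back to a pair. Equal letters contribute 0, as their commutator vanishes. *)
Definition merge_head c (z : block) l : int :=
  match z, l with
  | inl a, inl b :: l' => order_sign a b * c (mkpair a b :: l')
  | _, _ => 0
  end.

(* The boundary of the monomials in the free differential graded algebra on
   letters and pairs, with d (inr (b, a)) = ba - ab. *)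
Fixpoint list_bd c l : int :=
  if l is z :: l' then
    block_sign z * list_bd (fun m => c (z :: m)) l' + merge_head c z l'
  else 0.

Definition keep_face l m : Prop := exists u v b a,
  [/\ (a < b)%N, m = u ++ inr (b, a) :: v & l = u ++ inl b :: inl a :: v].

Definition swap_face l m : Prop := exists u v b a,
  [/\ (a < b)%N, m = u ++ inr (b, a) :: v & l = u ++ inl a :: inl b :: v].

Definition face l m : Prop := keep_face l m \/ swap_face l m.

Definition delta l m : int := (m == l)%:R.

Lemma flat_cons z l : flat (z :: l) = letters z ++ flat l.
Proof. by []. Qed.

Lemma flat_cat l m : flat (l ++ m) = flat l ++ flat m.
Proof. by rewrite /flat map_cat flatten_cat. Qed.

Lemma face_cons z l m : face l m -> face (z :: l) (z :: m).
Proof.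
by move=> [] [u [v [b [a [ab -> ->]]]]]; [left|right]; exists (z :: u), v, b, a.
Qed.

Lemma face_merge a b l : order_sign a b != 0 ->
  face (inl a :: inl b :: l) (mkpair a b :: l).
Proof.
rewrite /order_sign /mkpair; case: (ltngtP a b) => // ab _.
  by right; exists [::], l, b, a.
by left; exists [::], l, a, b.
Qed.

Lemma keep_face_consP l z m : keep_face l (z :: m) ->
  (exists2 l', l = z :: l' & keep_face l' m) \/
  (exists b a, [/\ (a < b)%N, z = inr (b, a) & l = inl b :: inl a :: m]).
Proof.
move=> [[|z' u] [v [b [a [ab]]]]] /= [-> ->] ->; first by right; exists b, a.
by left; exists (u ++ inl b :: inl a :: v) => //; exists u, v, b, a.
Qed.

Lemma eq_list_bd c c' l :
  (forall m, face l m -> c m = c' m) -> list_bd c l = list_bd c' l.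
Proof.
elim: l c c' => //= z l IH c c' h; congr (_ * _ + _).
  by apply: IH => m lm; apply/h/face_cons.
case: z l h {IH} => // a [//|[b|//] l] h /=.
have [->|ab] := eqVneq (order_sign a b) 0; first by rewrite !mul0r.
by rewrite h //; apply: face_merge.
Qed.

Lemma list_bd_sum (I : Type) (r : seq I) (Q : pred I) (k : I -> int)
    (F : I -> seq block -> int) l :
  list_bd (fun m => \sum_(j <- r | Q j) k j * F j m) l =
  \sum_(j <- r | Q j) k j * list_bd (F j) l.
Proof.
elim: l F => [|z l IH] F /=; first by rewrite big1 // => j _; rewrite mulr0.
rewrite IH mulr_sumr.
have -> : merge_head (fun m => \sum_(j <- r | Q j) k j * F j m) z l =
          \sum_(j <- r | Q j) k j * merge_head (F j) z l.
  case: z l {IH} => [a [|[b|p] l]|p l] /=; try by rewrite big1 // => j _; rewrite mulr0.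
  by rewrite mulr_sumr; apply: eq_bigr => j _; ring.
by rewrite -big_split; apply: eq_bigr => j _ /=; ring.
Qed.

Lemma list_bdZ (k : int) c l : list_bd (fun m => k * c m) l = k * list_bd c l.
Proof.
have := list_bd_sum [:: tt] predT (fun=> k) (fun=> c) l.
by rewrite big_seq1 => <-; apply: eq_list_bd => m _; rewrite big_seq1.
Qed.

Lemma list_bd0 c l : (forall m, c m = 0) -> list_bd c l = 0.
Proof.
move=> c0; rewrite (@eq_list_bd c (fun m => 0 * c m)) ?list_bdZ ?mul0r //.
by move=> m _; rewrite c0 mulr0.
Qed.

Lemma list_bdD c c' l :
  list_bd (fun m => c m + c' m) l = list_bd c l + list_bd c' l.
Proof.
have := list_bd_sum [:: c; c'] predT (fun=> 1) id l.
rewrite big_cons big_seq1 /= !mul1r => <-.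
by apply: eq_list_bd => m _; rewrite big_cons big_seq1 /= !mul1r.
Qed.

Lemma is_pair_mkpair a b : is_pair (mkpair a b).
Proof. by rewrite /mkpair; case: ifP. Qed.

Lemma merge_head_pair c z l : is_pair z -> merge_head c z l = 0.
Proof. by case: z. Qed.

(** Merges at disjoint places cancel, because the pair created on the left changes the sign of the
    merge on the right. Merges never overlap, since a pair is not merged again. *)
Lemma list_bd_bd c l : list_bd (list_bd c) l = 0.
Proof.
elim: l c => //= z l IH c.
rewrite list_bdD list_bdZ IH mulr0 add0r.
case: z => [a|p] /=; last by rewrite list_bd0 ?mulr0 ?addr0.
case: l {IH} => [|[b|p] l] /=; rewrite ?mulr0 ?add0r ?addr0 //=.
  rewrite (merge_head_pair _ _ (is_pair_mkpair a b)) addr0.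
  have /= -> : merge_head (fun m => merge_head c (inl a) m) (inl b) l = 0.
    case: l => [|[b'|//] l] //=.
    by rewrite /mkpair; case: ifP => _; rewrite mulr0.
  by rewrite list_bdZ /block_sign is_pair_mkpair /=; ring.
by rewrite list_bd0 ?mulr0.
Qed.

Lemma delta_cons z l m : delta (z :: l) (z :: m) = delta l m.
Proof. by rewrite /delta eqseq_cons eqxx. Qed.

Lemma list_bd_delta_cat u l m :
  list_bd (delta (u ++ m)) (u ++ l) = (-1) ^+ npairs u * list_bd (delta m) l.
Proof.
elim: u => [|z u IH]; first by rewrite mul1r.
rewrite cat_cons /= (@eq_list_bd _ (delta (u ++ m))); last by move=> k _; rewrite delta_cons.
rewrite IH [merge_head _ _ _](_ : _ = 0) ?addr0.
  by rewrite /block_sign /npairs /=; case: z => _ /=; rewrite ?exprS; ring.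
case: z (u ++ l) => // a [//|[b|//] k] /=.
rewrite /delta eqseq_cons; case: eqP => [e|]; last by rewrite mulr0.
by have := is_pair_mkpair a b; rewrite e.
Qed.

Lemma list_bd_delta_pair a b l : (a < b)%N ->
  list_bd (delta (inr (b, a) :: l)) (inl b :: inl a :: l) = 1 /\
  list_bd (delta (inr (b, a) :: l)) (inl a :: inl b :: l) = -1.
Proof.
move=> ab /=; rewrite !(@list_bd0 (fun m => delta _ (inl _ :: inl _ :: m)));
  try by move=> m; rewrite /delta eqseq_cons.
rewrite !mulr0 !add0r.
have /= z : forall x k,
    merge_head (fun m => delta (inr (b, a) :: l) (inl x :: m)) (inl k) l = 0.
  by move=> x k; case: l => [|[y|p] l] //=; rewrite /delta eqseq_cons /= mulr0.
rewrite !z !mulr0 !add0r /order_sign /mkpair /delta ab.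
by rewrite ltnNge (ltnW ab) /= !eqxx !mulr1.
Qed.

Lemma list_bd_delta_eq0 l m : ~ face l m -> list_bd (delta m) l = 0.
Proof.
move=> nf; rewrite (@eq_list_bd _ (fun=> 0)) ?list_bd0 //.
by move=> k lk; rewrite /delta; case: eqP => // e; rewrite e in lk.
Qed.

(** * Weights of words and the matching on block lists *)

(** The level used for the filtration: turning adjacent letters a b with a < b into b a raises it by
    b - a. *)
Fixpoint wgt (w : seq 'I_n) : nat :=
  if w is x :: w' then (x * size w' + wgt w')%N else 0%N.

Lemma face_npairs l m : face l m -> npairs m = (npairs l).+1.
Proof.
move=> [] [u [v [b [a [_ -> ->]]]]]; rewrite /npairs !count_cat /=; lia.
Qed.

Lemma keep_face_flat l m : keep_face l m -> flat l = flat m.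
Proof. by move=> [u [v [b [a [_ -> ->]]]]]; rewrite !flat_cat. Qed.

Lemma swap_face_wgt l m : swap_face l m -> (wgt (flat l) < wgt (flat m))%N.
Proof.
move=> [u [v [b [a [ab -> ->]]]]]; rewrite !flat_cat !flat_cons /=.
elim: (flat u) => [|x w IH] /=; first by nia.
by rewrite !size_cat /= ltn_add2l.
Qed.

Lemma face_wgt l m : face l m -> (wgt (flat l) <= wgt (flat m))%N.
Proof. by move=> [/keep_face_flat->//|/swap_face_wgt/ltnW]. Qed.

Lemma face_valid l m : face l m -> valid l = valid m.
Proof.
by move=> [] [u [v [b [a [ab -> ->]]]]]; rewrite /valid !all_cat /= ab.
Qed.

Lemma face_count l m : face l m -> forall x, count_mem x (flat l) = count_mem x (flat m).
Proof.
move=> [] [u [v [b [a [_ -> ->]]]]] x; rewrite !flat_cat !flat_cons !count_cat //=.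
by lia.
Qed.

(* [up l] is the cell matched with l if l is the lower one, [down l] if l is the
   upper one. *)
Fixpoint up l : option (seq block) :=
  match l with
  | inl x :: ((inl y :: l') as t) =>
      if (y < x)%N then Some (inr (x, y) :: l') else omap (cons (inl x)) (up t)
  | inl x :: (inr (b, a) as z) :: l' =>
      if (b < x)%N then omap (fun m => inl x :: z :: m) (up l') else None
  | _ => None
  end.

Fixpoint down l : option (seq block) :=
  match l with
  | inr (b, a) :: l' => Some (inl b :: inl a :: l')
  | inl x :: ((inl y :: l') as t) =>
      if (y < x)%N then None else omap (cons (inl x)) (down t)
  | inl x :: (inr (b, a) as z) :: l' =>
      if (b < x)%N then omap (fun m => inl x :: z :: m) (down l')
      else Some (inl x :: inl b :: inl a :: l')
  | _ => None
  end.

Definition crit l : bool := (up l == None) && (down l == None).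

(** The place where [up] merges. A triple counts as three letters, so positions refer to the
    word. *)
Fixpoint merge_pos l : nat :=
  match l with
  | inl x :: ((inl y :: l') as t) => if (y < x)%N then 0%N else (merge_pos t).+1
  | inl x :: inr (b, a) :: l' => (merge_pos l').+3
  | _ => 0%N
  end.

Lemma block_ind (Q : seq block -> Prop) :
    Q [::] -> (forall x, Q [:: inl x]) -> (forall p l, Q (inr p :: l)) ->
    (forall x y l, Q (inl y :: l) -> Q (inl x :: inl y :: l)) ->
    (forall x b a l, Q l -> Q (inl x :: inr (b, a) :: l)) ->
  forall l, Q l.
Proof.
move=> h0 h1 h2 h3 h4 l; have [k] := ubnP (size l).
elim: k l => // k IH [|[x|p] [|[y|[b a]] l]] //= lk.
  by apply: h3; apply: IH.
by apply: h4; apply: IH; lia.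
Qed.

Lemma up_letters x y l : up (inl x :: inl y :: l) =
  if (y < x)%N then Some (inr (x, y) :: l) else omap (cons (inl x)) (up (inl y :: l)).
Proof. by []. Qed.

Lemma up_letter_pair x b a l : up (inl x :: inr (b, a) :: l) =
  if (b < x)%N then omap (fun m => inl x :: inr (b, a) :: m) (up l) else None.
Proof. by []. Qed.

Lemma down_letters x y l : down (inl x :: inl y :: l) =
  if (y < x)%N then None else omap (cons (inl x)) (down (inl y :: l)).
Proof. by []. Qed.

Lemma down_letter_pair x b a l : down (inl x :: inr (b, a) :: l) =
  if (b < x)%N then omap (fun m => inl x :: inr (b, a) :: m) (down l)
  else Some (inl x :: inl b :: inl a :: l).
Proof. by []. Qed.

Lemma merge_pos_letters x y l : merge_pos (inl x :: inl y :: l) =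
  if (y < x)%N then 0%N else (merge_pos (inl y :: l)).+1.
Proof. by []. Qed.

Lemma up_keep_face l m : up l = Some m -> keep_face l m.
Proof.
elim/block_ind: l m => [|x|p l|x y l IH|x b a l IH] m //.
  rewrite up_letters; case: ifP => yx; first by move=> [<-]; exists [::], l, x, y.
  case e: (up _) => [m'|] //= [<-].
  by have [u [v [b [a [ab -> ->]]]]] := IH _ e; exists (inl x :: u), v, b, a.
rewrite up_letter_pair; case: ifP => // bx; case e: (up l) => [m'|] //= [<-].
have [u [v [b' [a' [ab -> ->]]]]] := IH _ e.
by exists [:: inl x, inr (b, a) & u], v, b', a'.
Qed.

Lemma down_keep_face l m : valid l -> down l = Some m -> keep_face m l.
Proof.
elim/block_ind: l m => [|x|[b a] l|x y l IH|x b a l IH] m //.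
- by move=> /andP[ab _] [<-]; exists [::], l, b, a.
- rewrite down_letters => vl; case: ifP => yx //.
  case e: (down _) => [m'|] //= [<-].
  by have [u [v [b [a [ab -> ->]]]]] := IH _ vl e; exists (inl x :: u), v, b, a.
- rewrite down_letter_pair => /andP[_ /andP[ab vl]]; case: ifP => bx; last first.
    by move=> [<-]; exists [:: inl x], l, b, a.
  case e: (down l) => [m'|] //= [<-].
  have [u [v [b' [a' [ab' -> ->]]]]] := IH _ vl e.
  by exists [:: inl x, inr (b, a) & u], v, b', a'.
Qed.

Lemma up_spec l m : up l = Some m -> [/\ down m = Some l, up m = None & down l = None].
Proof.
elim/block_ind: l m => [|x|p l|x y l IH|x b a l IH] m //.
  rewrite up_letters down_letters.
  case: ifP => yx; first by move=> [<-].
  case e: (up (inl y :: l)) => [m'|] // [<-].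
  (* Merging keeps the word, so [m'] still starts with the letter [y], possibly inside a pair, and
     its comparison with [x] is unchanged. *)
  have [d1 u1 ->] := IH _ e; have := keep_face_flat (up_keep_face e).
  case: m' {e} d1 u1 => [//|[z|[b a]] m'] d1 u1 [ez _].
    by rewrite down_letters up_letters d1 u1 -ez yx.
  by move: d1 => [_ <-]; rewrite down_letter_pair up_letter_pair -ez yx.
rewrite up_letter_pair down_letter_pair; case: ifP => // bx.
case e: (up l) => [m'|] // [<-]; rewrite down_letter_pair up_letter_pair bx.
by have [-> -> ->] := IH _ e.
Qed.

Lemma down_spec l m : valid l -> down l = Some m -> up m = Some l.
Proof.
elim/block_ind: l m => [|x|[b a] l|x y l IH|x b a l IH] m //.
- by move=> /andP[ab _] [<-]; rewrite up_letters ab.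
- rewrite down_letters => vl; case: ifP => yx //.
  case e: (down _) => [m'|] // [<-].
  have um := IH _ vl e; have := keep_face_flat (up_keep_face um).
  case: m' {e} um => [|[z|[b a]] m'] // um [ez _].
  by rewrite up_letters um ez yx.
- rewrite down_letter_pair => /andP[_ /andP[ab vl]]; case: ifP => bx.
    by case e: (down l) => [m'|] // [<-]; rewrite up_letter_pair bx (IH _ vl e).
  by move=> [<-]; rewrite !up_letters bx ab.
Qed.

Lemma merge_pos_le l : (merge_pos l <= size (flat l))%N.
Proof.
elim/block_ind: l => [|x|p l|x y l IH|x b a l IH] //.
by rewrite merge_pos_letters flat_cons size_cat; case: ifP.
Qed.

(* Only the removal of the pair of an earlier triple produces a lower cell, and
   that one is merged further to the left. *)
Lemma merge_pos_decr l m f : up l = Some m -> keep_face f m -> f <> l ->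
  up f <> None -> (merge_pos f < merge_pos l)%N.
Proof.
elim/block_ind: l m f => [|x|p l|x y l IH|x b a l IH] m f //.
  rewrite up_letters merge_pos_letters; case: ifP => yx.
    by move=> [<-] /keep_face_consP[[l' -> _]|[b [a [_ [<- <-] ->]]]].
  case e: (up (inl y :: l)) => [m'|] // [<-].
  move=> /keep_face_consP[[f' -> fm]|[b [a [_ //]]]] ne.
  have ne' : f' <> inl y :: l by move=> e'; apply: ne; rewrite e'.
  have := keep_face_flat (up_keep_face e); rewrite -(keep_face_flat fm).
  case: f' fm ne ne' => [//|[z|[b a]] f'] fm ne ne' [ez _].
    rewrite up_letters merge_pos_letters -ez yx; rewrite -ez in fm ne'.
    case e2: (up (inl y :: f')) => [g|] // _; rewrite ltnS.
    by apply: IH e fm ne' _; rewrite e2.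
  by rewrite up_letter_pair -ez yx.
rewrite up_letter_pair; case: ifP => // bx; case e: (up l) => [m'|] // [<-].
move=> /keep_face_consP[[f' -> fm]|[b' [a' [_ //]]]] ne.
have [[f2 e2 fm2]|[b' [a' [_ [e2 e3] e4]]]] := keep_face_consP fm.
  rewrite e2 in ne *; rewrite up_letter_pair bx; case e3: (up f2) => [g|] // _.
  rewrite /= !ltnS; apply: IH e fm2 _ _; last by rewrite e3.
  by move=> e4; apply: ne; rewrite e4.
by rewrite e4 merge_pos_letters -e2 bx.
Qed.

(** * Hexagons and the cycles through critical lists *)

Lemma pair_block_eq p q a b :
  (inr (p, q) == inr (b, a) :> block) = (p == b) && (q == a).
Proof. by []. Qed.

Lemma letter_block_eq p q : (inl p == inl q :> block) = (p == q).
Proof. by []. Qed.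

(** The coefficient of the commutator ba - ab at the word p q, as a polynomial in Kronecker deltas;
    in this form the hexagon identity is accessible to [ring]. *)
Lemma order_sign_mkpair p q a b : (a < b)%N ->
  order_sign p q * (mkpair p q == inr (b, a))%:R =
  (p == b)%:R * (q == a)%:R - (p == a)%:R * (q == b)%:R.
Proof.
move=> ab; rewrite -!natrM !mulnb /order_sign /mkpair.
case: (ltngtP p q) => pq; rewrite ?mul0r.
- rewrite mulN1r (_ : (p == b) && (q == a) = false) ?sub0r.
    by rewrite pair_block_eq andbC.
  by apply/negP => /andP[/eqP e1 /eqP e2]; subst; lia.
- rewrite mul1r (_ : (p == a) && (q == b) = false) ?subr0.
    by rewrite pair_block_eq.
  by apply/negP => /andP[/eqP e1 /eqP e2]; subst; lia.
- have <- : p = q by apply: val_inj.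
  by rewrite andbC subrr.
Qed.

(* The orders of the letters a < b < x form a hexagon, whose six edges are
   oriented here coherently. *)
Definition hexagon x b a (z z' : block) : int :=
  (z == inl x)%:R * (z' == inr (b, a))%:R
  + (z == inr (x, a))%:R * (z' == inl b)%:R
  + (z == inl a)%:R * (z' == inr (x, b))%:R
  - (z == inr (x, b))%:R * (z' == inl a)%:R
  - (z == inl b)%:R * (z' == inr (x, a))%:R
  - (z == inr (b, a))%:R * (z' == inl x)%:R.

Definition hexagon_prod x b a c l : int :=
  if l is z :: z' :: l' then hexagon x b a z z' * c l' else 0.

(** The Jacobi identity: the boundary of the hexagon is [x,[b,a]] + [b,[a,x]] + [a,[x,b]]. *)
Lemma hexagon_closed x b a p q r : (a < b)%N -> (b < x)%N ->
  order_sign q r * hexagon x b a (inl p) (mkpair q r) +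
  order_sign p q * hexagon x b a (mkpair p q) (inl r) = 0.
Proof.
move=> ab bx; have ax := ltn_trans ab bx.
have e1 := order_sign_mkpair q r ab; have e2 := order_sign_mkpair q r bx.
have e3 := order_sign_mkpair q r ax; have e4 := order_sign_mkpair p q ab.
have e5 := order_sign_mkpair p q bx; have e6 := order_sign_mkpair p q ax.
have nl z z' k : mkpair z z' == inl k = false.
  by apply/eqP => e; have := is_pair_mkpair z z'; rewrite e.
rewrite /hexagon !nl !letter_block_eq.
rewrite !(_ : forall (k : 'I_n) k', (inl k == inr k' :> block) = false) //.
transitivity (
  (p == x)%:R * (order_sign q r * (mkpair q r == inr (b, a))%:R)
  + (p == a)%:R * (order_sign q r * (mkpair q r == inr (x, b))%:R)
  - (p == b)%:R * (order_sign q r * (mkpair q r == inr (x, a))%:R)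
  + (order_sign p q * (mkpair p q == inr (x, a))%:R) * (r == b)%:R
  - (order_sign p q * (mkpair p q == inr (x, b))%:R) * (r == a)%:R
  - (order_sign p q * (mkpair p q == inr (b, a))%:R) * (r == x)%:R : int).
  by rewrite /=; ring.
by rewrite e1 e2 e3 e4 e5 e6; ring.
Qed.

Lemma hexagon_pairs x b a z z' : is_pair z -> is_pair z' -> hexagon x b a z z' = 0.
Proof. by case: z z' => // p [//|p'] _ _; rewrite /hexagon /= !mulr0 !mul0r !subr0. Qed.

(** Leibniz rule. Merges in the tail cancel as [c] is closed; a merge among the first three blocks
    either meets three letters, where [hexagon_closed] applies, or leaves two pairs, on which the
    hexagon vanishes. *)
Lemma hexagon_prod_closed x b a c : (a < b)%N -> (b < x)%N ->
  (forall l, list_bd c l = 0) -> forall l, list_bd (hexagon_prod x b a c) l = 0.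
Proof.
move=> ab bx c0 [|z [|z' l]] //.
- by rewrite /= !mulr0 add0r; case: z.
rewrite [LHS]/= list_bdZ c0 !mulr0 add0r.
case: l => [|z2 l].
  by case: z z' => [p|p] [q|q] /=; rewrite ?mulr0 ?addr0.
case: z z' => [p|p] [q|q] /=; rewrite ?mulr0 ?addr0 //.
  case: z2 => [r|r]; rewrite /block_sign ?mul1r ?mulr0 ?add0r /=.
    rewrite -[RHS](mul0r (c l)) -(@hexagon_closed x b a p q r ab bx); ring.
  by rewrite hexagon_pairs ?is_pair_mkpair // mul0r mulr0.
by case: z2 => [r|r]; rewrite ?mulr0 // hexagon_pairs ?is_pair_mkpair // mul0r !mulr0.
Qed.

Lemma hexagon_support x b a z z' : hexagon x b a z z' != 0 ->
  (z, z') \in [:: (inl x, inr (b, a)); (inr (x, a), inl b); (inl a, inr (x, b));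
                  (inr (x, b), inl a); (inl b, inr (x, a)); (inr (b, a), inl x)].
Proof.
apply: contraR; rewrite !inE !xpair_eqE !negb_or.
rewrite /hexagon -!natrM !mulnb.
by move=> /and5P[/negbTE-> /negbTE-> /negbTE-> /negbTE-> /andP[/negbTE-> /negbTE->]].
Qed.

Lemma crit_letters x y l :
  crit (inl x :: inl y :: l) = (x <= y)%N && crit (inl y :: l).
Proof.
rewrite /crit up_letters down_letters; case: ltnP => // _.
by case: (up (inl y :: l)); case: (down (inl y :: l)).
Qed.

Lemma crit_letter_pair x b a l :
  crit (inl x :: inr (b, a) :: l) = (b < x)%N && crit l.
Proof.
rewrite /crit up_letter_pair down_letter_pair; case: ifP => // _.
by case: (up l); case: (down l).
Qed.

(* The cycle is the product of the hexagons spanned by the triples of l. *)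
Lemma critical_cycle l : valid l -> crit l -> exists c,
  [/\ forall m, list_bd c m = 0, c l * c l = 1 &
      forall m, c m != 0 ->
        [/\ size (flat m) = size (flat l), npairs m = npairs l &
          (wgt (flat m) < wgt (flat l))%N \/
          flat m = flat l /\ (m = l \/ down m <> None)]].
Proof.
have single l0 : (forall m, face m l0 -> False) -> exists c : seq block -> int,
    [/\ forall m, list_bd c m = 0, c l0 * c l0 = 1 &
        forall m, c m != 0 -> m = l0].
  move=> nf; exists (delta l0); split.
  - by move=> m; apply: list_bd_delta_eq0 => /nf.
  - by rewrite /delta eqxx mulr1.
  - by move=> m; rewrite /delta; case: (m =P l0) => // _; rewrite eqxx.
have np l0 : npairs l0 = 0%N -> forall m, face m l0 -> False.
  by move=> n0 m /face_npairs; rewrite n0.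
elim/block_ind: l => [|x|p l|x y l IH|x b a l IH] //.
- move=> _ _; have [c [c0 c1 c2]] := single [::] (np [::] erefl).
  by exists c; split=> // m /c2 ->; split=> //; right; split => //; left.
- move=> _ _; have [c [c0 c1 c2]] := single [:: inl x] (np [:: inl x] erefl).
  by exists c; split=> // m /c2 ->; split=> //; right; split => //; left.
- by case: p.
- move=> vl; rewrite crit_letters => /andP[xy cl].
  have [c [c0 c1 cs]] := IH vl cl.
  exists (fun m => if m is z :: m' then (z == inl x)%:R * c m' else 0); split.
  + case=> [//|z m]; rewrite [LHS]/= list_bdZ c0 !mulr0 add0r.
    case: z m => [p|//] [//|[q|//] m] /=.
    rewrite (_ : (mkpair p q == inl x) = false) ?mul0r ?mulr0 //.
    by apply/eqP => e; have := is_pair_mkpair p q; rewrite e.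
  + by rewrite eqxx !mul1r.
  + case=> [//|z m]; have [->|_] := eqVneq z (inl x); last by rewrite mul0r eqxx.
    rewrite mul1r => /cs[e1 e2 e3].
    have fx k : flat (inl x :: k) = x :: flat k by [].
    split; [by rewrite !fx; congr (_.+1) | exact: e2 | rewrite !fx].
    case: e3 => [lt|[ef e3]].
      by left; rewrite -/(wgt (flat m)) [X in (X < _)%N]/= [X in (_ < X)%N]/= e1 ltn_add2l.
    rewrite ef; right; split => //; case: e3 => [->|dm]; first by left.
    (* The word of [m] starts with [y], which is not below [x]; so [down] passes over [x], or splits
       a pair standing right behind it. *)
    right; case: m dm ef {e1 e2} => [//|[z'|[b a]] m] dm [ez _].
      rewrite down_letters {1}ez ltnNge xy.
      by case: (down (inl z' :: m)) dm.
    by rewrite down_letter_pair ez ltnNge xy.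
- rewrite crit_letter_pair => /andP[_ /andP[ab vl]] /andP[bx cl].
  have [c [c0 c1 cs]] := IH vl cl; have ax := ltn_trans ab bx.
  have hx : hexagon x b a (inl x) (inr (b, a)) = 1.
    rewrite /hexagon !eqxx /= !letter_block_eq.
    rewrite -!val_eqE /= (gtn_eqF ax) (gtn_eqF bx).
    by rewrite ?mul1r ?mul0r ?mulr0 ?subr0 ?addr0.
  exists (hexagon_prod x b a c); split.
  + exact: hexagon_prod_closed.
  + by rewrite /= hx !mul1r.
  + case=> [//|z [//|z' m]]; rewrite /hexagon_prod mulf_eq0 negb_or.
    move=> /andP[/hexagon_support hs /cs[e1 e2 e3]].
    have wle : (wgt (flat m) <= wgt (flat l))%N by case: e3 => [/ltnW|[->]].
    (* Only two of the six edges read x b a: the triple itself, where [down] continues into [m], and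
       the pair (x, b) followed by a, which [down] splits. The other four have smaller words. *)
    move: hs; rewrite !inE => /or4P[|||/or3P[]] /eqP[-> ->]; split; rewrite ?flat_cons //=;
      rewrite ?e1 //; try (by rewrite /npairs /= -!/(npairs _) e2).
    * case: e3 => [lt|[-> e3]]; first by left; nia.
      right; split=> //; case: e3 => [->|dm]; first by left.
      by right; rewrite bx; case: (down m) dm.
    * by left; nia.
    * by left; nia.
    * case: e3 => [lt|[-> e3]]; first by left; nia.
      by right; split => //; right.
    * by left; nia.
    * by left; nia.
Qed.

(** * Reading critical lists off words *)

(** The only candidate for a critical list over a word: weak ascents are passed over, a descent must
    begin a triple x > b > a, and reading resumes behind the triple without a comparison. *)
Fixpoint crit_word (w : seq 'I_n) : option (seq block) :=
  match w with
  | [::] => Some [::]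
  | [:: x] => Some [:: inl x]
  | x :: ((y :: t) as w') =>
      if (x <= y)%N then omap (cons (inl x)) (crit_word w')
      else if t is z :: t' then
        if (z < y)%N then omap (fun l => inl x :: inr (y, z) :: l) (crit_word t')
        else None
      else None
  end.

Lemma crit_word_letters x y w : (x <= y)%N ->
  crit_word (x :: y :: w) = omap (cons (inl x)) (crit_word (y :: w)).
Proof. by rewrite [crit_word _]/= => ->. Qed.

Lemma crit_word_triple x y z w : (y < x)%N ->
  crit_word (x :: y :: z :: w) =
  if (z < y)%N then omap (fun l => inl x :: inr (y, z) :: l) (crit_word w) else None.
Proof. by rewrite [crit_word _]/= ltnNge => /negbTE->. Qed.

Lemma crit_word_spec w l : crit_word w = Some l -> [/\ flat l = w, valid l & crit l].
Proof.
have [k] := ubnP (size w); elim: k w l => // k IH [|x [|y w]] l wk.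
- by move=> [<-].
- by move=> [<-].
have [xy|yx] := leqP x y.
  rewrite crit_word_letters //; case e: (crit_word _) => [m|] // [<-].
  have [//|fm vm cm] := IH _ _ _ e.
  split=> //; first by rewrite flat_cons fm.
  by case: m fm cm {e vm} => [//|[z|[b a]] m] // [-> _] cm; rewrite crit_letters xy.
case: w wk => [|z w] wk; first by rewrite /= leqNgt yx.
rewrite crit_word_triple //; case: ifP => // zy.
case e: (crit_word w) => [m|] // [<-].
have [|fm vm cm] := IH _ _ _ e; first by rewrite /= in wk; lia.
by rewrite crit_letter_pair !flat_cons fm yx /valid /= zy.
Qed.

Lemma crit_word_flat l : valid l -> crit l -> crit_word (flat l) = Some l.
Proof.
elim/block_ind: l => [|x|[b a] l|x y l IH|x b a l IH] //.
  rewrite crit_letters => vl /andP[xy cl].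
  rewrite (_ : flat _ = x :: y :: flat l) // crit_word_letters //.
  by rewrite (_ : y :: flat l = flat (inl y :: l)) // IH.
rewrite crit_letter_pair => /andP[_ /andP[ab vl]] /andP[bx cl].
by rewrite (_ : flat _ = [:: x, b, a & flat l]) // crit_word_triple // ab IH.
Qed.

Definition descent_bits (w : seq 'I_n) : seq bool :=
  if w is x :: w' then pairmap (fun a b : 'I_n => (b < a)%N) x w' else [::].

(** Reading uses the word only through its descents, and the pairs produced are the triples counted
    by the scan. *)
Lemma crit_word_bits w : omap npairs (crit_word w) = parse_bits (descent_bits w).
Proof.
have [k] := ubnP (size w); elim: k w => // k IH [|x [|y w]] wk //.
have [xy|yx] := leqP x y.
  rewrite crit_word_letters // (_ : descent_bits _ = (y < x)%N :: descent_bits (y :: w)) //.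
  rewrite ltnNge xy (_ : parse_bits _ = parse_bits (descent_bits (y :: w))) //.
  by rewrite -IH //; case: (crit_word (y :: w)).
case: w wk => [|z w] wk; first by rewrite /= leqNgt yx.
rewrite crit_word_triple //.
rewrite (_ : descent_bits _ = [:: (y < x)%N, (z < y)%N & descent_bits (z :: w)]) // yx.
case: ifP => // zy.
rewrite (_ : parse_bits _ = omap S (parse_bits (behead (descent_bits (z :: w))))); last first.
  by rewrite /=; case: (pairmap _ _ _).
rewrite (_ : behead _ = descent_bits w); last by case: w {wk}.
by rewrite -IH; [case: (crit_word w) | rewrite /= in wk; lia].
Qed.

Lemma mem_descents (w : seq 'I_n) j :
  (j \in descents [seq val x | x <- w]) = bit (descent_bits w) j.
Proof.
rewrite mem_filter mem_iota size_map /bit; case: w => [|x w] /=.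
  by case: j => [|j] //=; rewrite ?nth_nil ?andbF //; lia.
case: j => [|j] /=; first by rewrite andbF.
rewrite add1n ltnS; have [jw|wj] := ltnP j (size w); last first.
  by rewrite andbF nth_default // size_pairmap.
rewrite andbT (nth_pairmap x) // -[val x :: _](map_cons val) !(nth_map x) //=.
by rewrite ltnW.
Qed.

End BlockLists.
(** * Cells of Hom complexes *)

Section HomCells.
Variables (dA dB : Order.disp_t) (A : finPOrderType dA) (B : finPOrderType dB).
Implicit Types (X Y Z : hom_cell A B) (a : A) (b : B).

Lemma cell_neq0 X a : X a != set0.
Proof. by have /andP[/forallP] := valP X. Qed.

Lemma cell_sub (X0 : {ffun A -> {set B}}) Y :
  (forall a, X0 a != set0) -> (forall a, X0 a \subset Y a) -> is_cell X0.
Proof.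
move=> n0 sub; apply/andP; split; first exact/forallP.
have /andP[_ /forallP mono] := valP Y.
apply/forallP => eta; apply/implyP => /forallP h; apply: (implyP (mono eta)).
by apply/forallP => a; apply: (subsetP (sub a)).
Qed.

Lemma cell_mono X a a' b b' : (a < a')%O -> b \in X a -> b' \in X a' -> (b < b')%O.
Proof.
move=> aa' bX bX'; have /andP[_ /forallP mono] := valP X.
(* A selection with two prescribed values; the default [b] is never taken, as every [X c] is
   nonempty. *)
pose eta := [ffun c => if c == a then b else if c == a' then b' else
               odflt b [pick y in X c]].
have /implyP := mono eta; move=> h.
have /forallP/(_ a)/forallP/(_ a')/implyP/(_ aa') :
    [forall a, forall a', (a < a')%O ==> (eta a < eta a')%O].
  apply: h; apply/forallP => c; rewrite ffunE.
  have [->//|_] := eqVneq c a; have [->//|_] := eqVneq c a'.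
  case: pickP => //= n0; have /set0Pn[y yX] := cell_neq0 X c.
  by have := n0 y; rewrite yX.
by rewrite !ffunE !eqxx (gt_eqF aa').
Qed.

Lemma remove_vertexE X a b a' :
  remove_vertex X a b a' = if a' == a then X a' :\ b else X a'.
Proof. by rewrite ffunE. Qed.

(** Removing from [Y] a single vertex missing in [X] gives a cell between the two, which must be
    [X]. *)
Lemma covered_remove X Y : covered X Y ->
  exists a, exists2 b, b \in Y a & cell_val X = remove_vertex Y a b.
Proof.
move=> /andP[]; rewrite lt_neqAle => /andP[neq /forallP le] /existsPn nz.
have [a] : exists a, ~~ (Y a \subset X a).
  apply/existsP; rewrite -negb_forall; apply: contra neq => /forallP ge.
  apply/eqP/val_inj/ffunP => a; apply/eqP.
  by rewrite eqEsubset (le a) (ge a).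
move=> /subsetPn[b bY bX]; exists a, b => //.
have cZ : is_cell (remove_vertex Y a b).
  apply: (@cell_sub _ Y) => c; rewrite remove_vertexE; case: (c =P a) => [->|_].
  - have /set0Pn[y yX] := cell_neq0 X a; apply/set0Pn; exists y.
    by rewrite !inE (subsetP (le a)) // andbT; apply: contraNneq bX => <-.
  - exact: cell_neq0.
  - by rewrite subsetDl.
  - by [].
pose Z : hom_cell A B := HomCell cZ.
have XZ : (X <= Z)%O.
  apply/forallP => c; rewrite /= remove_vertexE; case: (c =P a) => [->|_]; last exact: le.
  by rewrite subsetD1 (le a).
have ZY : (Z < Y)%O.
  rewrite lt_neqAle; apply/andP; split.
    apply/eqP => e; move: bY; rewrite -e /= remove_vertexE eqxx !inE eqxx //.
  by apply/forallP => c; rewrite /= remove_vertexE; case: (c =P a) => // _; rewrite subsetDl.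
have := nz Z; rewrite ZY andbT; have [->//|nXZ] := eqVneq X Z.
by rewrite lt_neqAle nXZ XZ.
Qed.

Lemma remove_covered X Y a b :
  b \in Y a -> cell_val X = remove_vertex Y a b -> covered X Y.
Proof.
move=> bY eX.
have Xc c : X c = if c == a then Y c :\ b else Y c by rewrite eX remove_vertexE.
apply/andP; split.
  rewrite lt_neqAle; apply/andP; split.
    by apply/eqP => e; move: bY; rewrite -e Xc eqxx !inE eqxx.
  by apply/forallP => c; rewrite Xc; case: (c =P a) => // _; rewrite subsetDl.
apply/existsPn => Z; apply/negP => /andP[].
rewrite !lt_neqAle => /andP[nXZ /forallP XZ] /andP[nZY /forallP ZY].
have ZYc c : c != a -> Z c = Y c.
  move=> ca; apply/eqP; rewrite eqEsubset ZY /=; have := XZ c.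
  by rewrite Xc (negbTE ca).
have [bZ|bZ] := boolP (b \in Z a).
  move/eqP: nZY; apply; apply/val_inj/ffunP => c.
  have [->|/ZYc //] := eqVneq c a; apply/eqP; rewrite eqEsubset ZY /=.
  by apply/subsetP => y yY; have [->//|yb] := eqVneq y b;
     apply: (subsetP (XZ a)); rewrite Xc eqxx !inE yb.
move/eqP: nXZ; apply; apply/val_inj/ffunP => c.
have [->|ca] := eqVneq c a; last by rewrite ZYc // Xc (negbTE ca).
apply/eqP; rewrite eqEsubset XZ /= Xc eqxx.
by apply/subsetP => y yZ; rewrite !inE (subsetP (ZY a)) // andbT; apply: contraNneq bZ => <-.
Qed.

Lemma remove_vertex_inj Y a b a' b' : b \in Y a -> b' \in Y a' ->
  remove_vertex Y a b = remove_vertex Y a' b' -> (a, b) = (a', b').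
Proof.
move=> bY bY' e; have := congr1 (fun f : {ffun A -> {set B}} => b \in f a) e.
rewrite !remove_vertexE eqxx !inE eqxx /=; case: (a =P a') => [<-|_]; last by rewrite bY.
by rewrite !inE bY andbT; case: (b =P b') => // ->.
Qed.

Lemma cell_incidence_remove X Y a b :
    b \in Y a -> cell_val X = remove_vertex Y a b ->
  cell_incidence Y X =
  (-1) ^+ (\sum_(a' | (enum_rank a' < enum_rank a)%N) #|Y a'|.-1 +
           #|[set b' in Y a | (enum_rank b' < enum_rank b)%N]|)%N.
Proof.
move=> bY eX; rewrite /cell_incidence (big_pred1 (a, b)) //= => -[a' b'] /=.
apply/andP/eqP => [[bY' /eqP e]|[-> ->]]; last by rewrite bY eX eqxx.
by apply: (remove_vertex_inj bY' bY); rewrite -eX.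
Qed.

Lemma cell_incidence_covered X Y : cell_incidence Y X != 0 -> covered X Y.
Proof.
apply: contraNT => nc; rewrite /cell_incidence big_pred0 // => -[a b] /=.
apply/negP => /andP[bY /eqP eX]; move: nc; apply/negP; rewrite negbK.
exact: remove_covered eX.
Qed.

Lemma cell_incidence_sqr X Y : covered X Y ->
  cell_incidence Y X * cell_incidence Y X = 1.
Proof.
move=> /covered_remove[a [b bY eX]]; rewrite (cell_incidence_remove bY eX).
by rewrite -expr2 sqrr_sign.
Qed.

End HomCells.

(** * Prefixes of words with unordered pairs *)

Section Prefixes.
Variable n : nat.
Local Notation block := (block n).
Implicit Types (l u v : seq block) (w : seq 'I_n).

(* The words of length k that are prefixes of a word obtained from l by ordering
   each of its pairs, with completed pairs written in decreasing order. *)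
Fixpoint prefixes l (k : nat) : seq (seq 'I_n) :=
  match l, k with
  | _, 0 => [:: [::]]
  | [::], _ => [::]
  | inl x :: l', k'.+1 => [seq x :: w | w <- prefixes l' k']
  | inr (b, a) :: l', 1 => [:: [:: b]; [:: a]]
  | inr (b, a) :: l', k'.+2 => [seq [:: b, a & w] | w <- prefixes l' k']
  end.

Lemma prefixes0 l : prefixes l 0 = [:: [::]].
Proof. by case: l => [|[x|[b a]] l]. Qed.

Lemma prefixes_cat u v k :
  prefixes (u ++ v) (size (flat u) + k) = [seq flat u ++ w | w <- prefixes v k].
Proof.
elim: u => [|[x|[b a]] u IH]; first by rewrite map_id.
  by rewrite cat_cons flat_cons /= IH -map_comp.
by rewrite cat_cons flat_cons /= IH -map_comp.
Qed.

Lemma prefixes_catl u v v' k : (k <= size (flat u))%N ->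
  prefixes (u ++ v) k = prefixes (u ++ v') k.
Proof.
elim: u k => [|[x|[b a]] u IH] [|k] //; rewrite ?prefixes0 // flat_cons.
  by move=> ku; rewrite !cat_cons /= (IH k).
case: k => [|k] ku //; by rewrite !cat_cons /= (IH k).
Qed.

Variant prefixes_spec l k : Prop :=
  | PrefixesOne w of prefixes l k = [:: w]
  | PrefixesTwo u v b a of l = u ++ inr (b, a) :: v & k = (size (flat u)).+1.

Lemma prefixesP l k : (k <= size (flat l))%N -> prefixes_spec l k.
Proof.
elim: l k => [|[x|[b a]] l IH] [|k]; rewrite ?flat_cons ?size_cat //= => kl.
- by apply: (@PrefixesOne _ _ [::]).
- by apply: (@PrefixesOne _ _ [::]).
- case: (IH k) => [//|w e|u v b a e1 e2].
    by apply: (@PrefixesOne _ _ (x :: w)); rewrite /= e.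
  by apply: (@PrefixesTwo _ _ (inl x :: u) v b a); rewrite ?e1 // flat_cons e2.
- by apply: (@PrefixesOne _ _ [::]).
case: k kl => [|k] kl; first by apply: (@PrefixesTwo _ _ [::] l b a).
case: (IH k) => [//|w e|u v b' a' e1 e2].
  by apply: (@PrefixesOne _ _ [:: b, a & w]); rewrite /= e.
by apply: (@PrefixesTwo _ _ (inr (b, a) :: u) v b' a'); rewrite ?e1 // flat_cons e2.
Qed.

Lemma prefixes_two u v b a :
  prefixes (u ++ inr (b, a) :: v) (size (flat u)).+1 =
  [:: flat u ++ [:: b]; flat u ++ [:: a]].
Proof. by rewrite -addn1 prefixes_cat. Qed.

Lemma prefixes_size l k w : w \in prefixes l k -> size w = k.
Proof.
elim: l k w => [|[x|[b a]] l IH] [|k] w //=; rewrite ?inE; try by move/eqP->.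
  by move=> /mapP[w' /IH e ->]; rewrite /= e.
case: k => [|k]; first by rewrite !inE => /orP[]/eqP->.
by move=> /mapP[w' /IH e ->]; rewrite /= e.
Qed.

Lemma prefixes_sub l k w : w \in prefixes l k ->
  forall j, (count_mem j w <= count_mem j (flat l))%N.
Proof.
elim: l k w => [|[x|[b a]] l IH] [|k] w; rewrite ?prefixes0 ?inE //;
  try by move=> /eqP->.
  by move=> /= /mapP[w' /IH e ->] j; rewrite leq_add2l; apply: e.
case: k => [|k].
  by rewrite !inE => /orP[]/eqP-> j; rewrite flat_cons count_cat /=; lia.
by move=> /= /mapP[w' /IH e ->] j; rewrite /= !leq_add2l; apply: e.
Qed.

Lemma prefixes_mono l k k' w w' : (k < k')%N ->
  w \in prefixes l k -> w' \in prefixes l k' ->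
  forall j, (count_mem j w <= count_mem j w')%N.
Proof.
elim: l k k' w w' => [|[x|[b a]] l IH] [|k] [|k'] w w' //; rewrite ?prefixes0 ?inE;
  try by move=> _ /eqP->.
  move=> kk' /= /mapP[v vl ->] /mapP[v' vl' ->] j; rewrite /= leq_add2l.
  by apply: IH vl vl' _.
case: k k' => [|k] [|k'] // kk'.
  by rewrite /= !inE => /orP[]/eqP-> /mapP[v' vl' ->] j /=; lia.
move=> /= /mapP[v vl ->] /mapP[v' vl' ->] j; rewrite /= !leq_add2l.
by apply: IH vl vl' _.
Qed.

(** Only the rank between the two letters of a pair carries two prefixes. With empty [v] this
    computes the dimension, in general an exponent in the incidence number. *)
Lemma sum_prefixes u v :
  (\sum_(0 <= k < (size (flat u)).+1) (size (prefixes (u ++ v) k)).-1 = npairs u)%N.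
Proof.
elim: u => [|[x|[b a]] u IH].
- by rewrite big_nat1 prefixes0.
- rewrite flat_cons [size _]/= big_nat_recl // prefixes0 /= add0n -IH.
  by apply: eq_bigr => k _; rewrite size_map.
- rewrite flat_cons [size _]/= big_nat_recl // big_nat_recl // prefixes0 /= add0n.
  by rewrite /npairs /= -/(npairs u) -IH; congr (_ + _)%N; apply: eq_bigr => k _; rewrite size_map.
Qed.

Lemma size_count_mem w : size w = (\sum_j count_mem j w)%N.
Proof.
elim: w => [|x w IH] /=; first by rewrite big1.
rewrite big_split /= -IH (bigD1 x) //= eqxx big1 // => j jx.
by rewrite eq_sym (negbTE jx).
Qed.

End Prefixes.

Lemma eq_sum_leq (I : finType) (f g : I -> nat) :
  (forall k, f k <= g k)%N -> (\sum_k g k <= \sum_k f k)%N -> f =1 g.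
Proof.
move=> fg le k; apply/eqP; rewrite eqn_leq fg /=; move: le.
rewrite (bigD1 k) //= [in X in (_ <= X)%N -> _](bigD1 k) //= => le.
have : (\sum_(i | i != k) f i <= \sum_(i | i != k) g i)%N by apply: leq_sum.
lia.
Qed.

(** * Cells of Hom(i) as block lists *)

Section ChainProductCells.
Variables (n : nat) (i : 'I_n -> nat).
Local Notation block := (block n).
Local Notation B := (chain_prod i).
Local Notation A := ('I_(ell i).+1).
Implicit Types (l u v : seq block) (w : seq 'I_n) (x y z : B).

Definition bounded w : Prop := forall j, (count_mem j w <= i j)%N.

(** The vertex reached by the lattice path [w]; [inord] keeps the counts only for [bounded]
    words. *)
Definition point w : B := [ffun j => inord (count_mem j w) : 'I_(i j).+1].

Lemma pointE w j : bounded w -> point w j = count_mem j w :> nat.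
Proof. by move=> bw; rewrite ffunE inordK // ltnS. Qed.

Lemma eq_point w w' : (forall j, count_mem j w = count_mem j w') -> point w = point w'.
Proof. by move=> e; apply/ffunP => j; rewrite !ffunE e. Qed.

Lemma point_inj w w' : bounded w -> bounded w' -> point w = point w' ->
  forall j, count_mem j w = count_mem j w'.
Proof. by move=> bw bw' e j; rewrite -!pointE // e. Qed.

Definition height x : nat := (\sum_j x j)%N.

Lemma chain_prod_leP x y : reflect (forall j, (x j <= y j)%N) (x <= y)%O.
Proof. by apply: (iffP forallP) => h j; have := h j; rewrite leEord. Qed.

Lemma height_point w : bounded w -> height (point w) = size w.
Proof.
by move=> bw; rewrite size_count_mem; apply: eq_bigr => j _; rewrite pointE.
Qed.

Lemma height_le x : (height x <= ell i)%N.
Proof. by apply: leq_sum => j _; rewrite -ltnS. Qed.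

Lemma height_lt x y : (x < y)%O -> (height x < height y)%N.
Proof.
rewrite lt_neqAle => /andP[neq /chain_prod_leP le]; rewrite ltnNge.
apply: contra neq => ge; apply/eqP/ffunP => j; apply: val_inj.
exact: (eq_sum_leq le ge).
Qed.

Lemma point_lt w w' : bounded w -> bounded w' -> (size w < size w')%N ->
  (forall j, count_mem j w <= count_mem j w')%N -> (point w < point w')%O.
Proof.
move=> bw bw' sz le; rewrite lt_neqAle; apply/andP; split.
  by apply: contraTneq sz => e; rewrite -!height_point // e ltnn.
by apply/chain_prod_leP => j; rewrite !pointE.
Qed.

Lemma point_step w y : bounded w -> (point w < y)%O -> height y = (size w).+1 ->
  exists2 j, bounded (w ++ [:: j]) & y = point (w ++ [:: j]).
Proof.
move=> bw lt hy; have /chain_prod_leP le := ltW lt.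
have [j lj] : exists j, (point w j < y j)%N.
  apply/existsP; apply: contraTT lt => /existsPn ge; rewrite lt_neqAle.
  rewrite (_ : point w = y) ?eqxx //; apply/ffunP => j; apply: val_inj => /=.
  by apply/eqP; rewrite eqn_leq le leqNgt ge.
have e : (fun k => count_mem k w + (j == k))%N =1 (fun k => y k : nat).
  apply: eq_sum_leq => [k|].
    have := le k; rewrite pointE //; case: (j =P k) => [<-|]; last by rewrite addn0.
    by move=> _; rewrite addn1 -(pointE j bw).
  rewrite -/(height y) hy big_split /= -size_count_mem (bigD1 j) //= eqxx.
  by rewrite -addn1 leq_add2l leq_addr.
have bj : bounded (w ++ [:: j]).
  by move=> k; rewrite count_cat /= addn0 e -ltnS.
exists j => //; apply/ffunP => k; apply: val_inj => /=.
by rewrite pointE // count_cat /= addn0 e.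
Qed.

Definition good l : Prop := valid l /\ forall j, count_mem j (flat l) = i j.

Lemma good_size l : good l -> size (flat l) = ell i.
Proof. by move=> [_ c]; rewrite size_count_mem; apply: eq_bigr => j _; rewrite c. Qed.

Lemma good_prefixes l k w : good l -> w \in prefixes l k -> bounded w.
Proof. by move=> [_ c] /prefixes_sub h j; rewrite -c. Qed.

Lemma good_face l m : face l m -> good l <-> good m.
Proof.
move=> lm; rewrite /good (face_valid lm).
by split=> -[v c]; split=> // j; rewrite -c (face_count lm).
Qed.

Definition list_cell l : {ffun A -> {set B}} :=
  [ffun a : A => [set x in [seq point w | w <- prefixes l a]]].

Lemma list_cellP l (a : A) x :
  reflect (exists2 w, w \in prefixes l a & x = point w) (x \in list_cell l a).
Proof. by rewrite ffunE inE; apply: mapP. Qed.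

Lemma list_cell_is_cell l : good l -> is_cell (list_cell l).
Proof.
move=> gl; apply/andP; split; apply/forallP.
  move=> a; have al : (a <= size (flat l))%N by rewrite good_size // -ltnS.
  case: (prefixesP al) => [w e|u v b c e1 e2]; apply/set0Pn.
    by exists (point w); apply/list_cellP; exists w; rewrite // e mem_head.
  exists (point (flat u ++ [:: b])); apply/list_cellP.
  by exists (flat u ++ [:: b]); rewrite // e1 e2 prefixes_two mem_head.
move=> eta; apply/implyP => /forallP h.
apply/forallP => a; apply/forallP => a'; apply/implyP; rewrite ltEord => aa'.
have /list_cellP[w wl ->] := h a; have /list_cellP[w' wl' ->] := h a'.
apply: point_lt; rewrite ?(prefixes_size wl) ?(prefixes_size wl') //.
- exact: good_prefixes wl.
- exact: good_prefixes wl'.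
- exact: prefixes_mono wl wl'.
Qed.

Lemma valid_pair u v (b a : 'I_n) : valid (u ++ inr (b, a) :: v) -> (a < b)%N.
Proof. by rewrite /valid all_cat => /and3P[]. Qed.

Lemma good_pair_prefix u v (b a : 'I_n) : good (u ++ inr (b, a) :: v) ->
  [/\ (a < b)%N, bounded (flat u ++ [:: b]) & bounded (flat u ++ [:: a])].
Proof.
move=> gl; have := good_prefixes (k := (size (flat u)).+1) gl.
rewrite prefixes_two => h; split; first exact: valid_pair gl.1.
  by apply: h; rewrite mem_head.
by apply: h; rewrite !inE eqxx orbT.
Qed.

Lemma point_pair_neq u v (b a : 'I_n) : good (u ++ inr (b, a) :: v) ->
  point (flat u ++ [:: b]) != point (flat u ++ [:: a]).
Proof.
move=> /good_pair_prefix[ab bb ba]; apply/eqP => /(point_inj bb ba) /(_ b).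
rewrite !count_cat /= eqxx !addn0 => /eqP; rewrite eqn_add2l eq_sym eqb1 => /eqP e.
by rewrite e ltnn in ab.
Qed.

Lemma card_list_cell l (a : A) : good l -> #|list_cell l a| = size (prefixes l a).
Proof.
move=> gl; have al : (a <= size (flat l))%N by rewrite good_size // -ltnS.
rewrite ffunE cardsE -(size_map point) /=.
apply/card_uniqP; case: (prefixesP al) => [w ->//|u v b c e1 e2].
by rewrite e1 in gl *; rewrite e2 prefixes_two /= inE andbT (point_pair_neq gl).
Qed.

Lemma dim_list_cell (X : Hom_i i) l : good l -> cell_val X = list_cell l ->
  cell_dim X = npairs l.
Proof.
move=> gl eX; rewrite -(sum_prefixes l [::]) cats0 good_size // big_mkord.
by apply: eq_bigr => a _; rewrite eX card_list_cell.
Qed.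

Lemma list_cell_split (Y : Hom_i i) u v (b a : 'I_n) (p : A) :
    good (u ++ inr (b, a) :: v) -> p = (size (flat u)).+1 :> nat ->
    cell_val Y = list_cell (u ++ inr (b, a) :: v) ->
  [/\ Y p = [set point (flat u ++ [:: b]); point (flat u ++ [:: a])],
      list_cell (u ++ inl b :: inl a :: v) =
        remove_vertex Y p (point (flat u ++ [:: a])) &
      list_cell (u ++ inl a :: inl b :: v) =
        remove_vertex Y p (point (flat u ++ [:: b]))].
Proof.
move=> gl ep eY.
have Yp : Y p = [set point (flat u ++ [:: b]); point (flat u ++ [:: a])].
  by rewrite eY ffunE ep prefixes_two; apply/setP => x; rewrite !inE.
have nba := point_pair_neq gl.
have main (c c' : 'I_n) : (c = b /\ c' = a) \/ (c = a /\ c' = b) ->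
    list_cell (u ++ inl c :: inl c' :: v) = remove_vertex Y p (point (flat u ++ [:: c'])).
  move=> cc'; apply/ffunP => k; rewrite remove_vertexE.
  have [->|kp] := eqVneq k p.
    have -> : list_cell (u ++ inl c :: inl c' :: v) p = [set point (flat u ++ [:: c])].
      by rewrite ffunE ep -addn1 prefixes_cat /=; apply/setP => x; rewrite !inE.
    rewrite Yp; case: cc' => -[-> ->]; apply/setP => x; rewrite !inE.
      by have [->|] := eqVneq x (point (flat u ++ [:: b])); rewrite ?nba //= andNb.
    have [->|] := eqVneq x (point (flat u ++ [:: a])); rewrite ?orbT ?andbT ?orbF ?andNb //.
    by rewrite eq_sym nba.
  rewrite eY !ffunE; have [ku|uk] := leqP k (size (flat u)).
    by rewrite (prefixes_catl _ (inr (b, a) :: v) ku).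
  (* Behind the pair the order of its letters is invisible, for [point] only counts. *)
  have [k' ek] : exists k', (k = size (flat u) + k'.+2 :> nat)%N.
    exists (k - (size (flat u)).+2)%N.
    suff : (k : nat) != (size (flat u)).+1 by lia.
    by rewrite -ep val_eqE.
  rewrite ek !prefixes_cat /= -!map_comp; apply/setP => x; rewrite !inE.
  congr (x \in _); apply: eq_map => w /=; apply: eq_point => j.
  by case: cc' => -[-> ->]; rewrite !count_cat //=; lia.
by split=> //; [apply: main; left | apply: main; right].
Qed.

(** The first block is read off the one or two points just above [point w]; a pair is recovered from
    its points because its larger letter comes first. Induction continues with a longer [w]. *)
Lemma list_cell_inj_from w l l' :
    valid l -> valid l' -> bounded (w ++ flat l) -> bounded (w ++ flat l') ->
    size (flat l) = size (flat l') ->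
    (forall k, (k <= size (flat l))%N ->
       [seq point (w ++ s) | s <- prefixes l k] =i
       [seq point (w ++ s) | s <- prefixes l' k]) ->
  l = l'.
Proof.
have bsub s t r : bounded (s ++ (t ++ r)) -> bounded (s ++ t).
  by move=> h j; apply: leq_trans (h j); rewrite !count_cat addnA leq_addr.
have one s (c d : 'I_n) : bounded (s ++ [:: c]) -> bounded (s ++ [:: d]) ->
    point (s ++ [:: c]) = point (s ++ [:: d]) -> c = d.
  move=> bc bd /(point_inj bc bd)/(_ c); rewrite !count_cat /= eqxx !addn0.
  by move=> /eqP; rewrite eqn_add2l eq_sym eqb1 => /eqP.
have [N] := ubnP (size l); elim: N l l' w => // N IH [|z l] [|z' l'] w.
- by [].
- by case: z' => [x|[b a]].
- by case: z => [x|[b a]].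
rewrite ltnS => lN vl vl' bl bl' esz ek.
case: z z' lN vl vl' bl bl' esz ek => [x|[b a]] [x'|[b' a']] lN vl vl'; rewrite !flat_cons.
- move=> bl bl' [esz] ek.
  have ex : x = x'.
    have := ek 1%N isT (point (w ++ [:: x])); rewrite /= !prefixes0 /= !inE eqxx.
    move=> /esym/eqP/one; apply; [exact: bsub bl | exact: bsub bl'].
  rewrite -ex; congr (_ :: _); apply: (IH _ _ (w ++ [:: x])) => //.
  + by rewrite -catA.
  + by rewrite -catA ex.
  move=> k kl y; have := ek k.+1 kl y; rewrite /= -ex -!map_comp.
  by congr (_ = _); congr (y \in _); apply: eq_map => s /=; rewrite -catA.
- move=> bl bl' esz ek; move: vl' => /andP[ab' _].
  have bb : bounded (w ++ [:: b']) by apply: (bsub _ _ (a' :: flat l')).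
  have ba : bounded (w ++ [:: a']).
    move=> j; apply: leq_trans (bl' j); rewrite !count_cat /=; lia.
  have bx : bounded (w ++ [:: x]) by apply: bsub bl.
  have := ek 1%N isT; rewrite /= !prefixes0 /= => e.
  have := e (point (w ++ [:: a'])); rewrite !inE eqxx orbT => /eqP/(one _ _ _ ba bx) e1.
  have := e (point (w ++ [:: b'])); rewrite !inE eqxx => /eqP/(one _ _ _ bb bx) e2.
  by rewrite e1 e2 ltnn in ab'.
- move=> bl bl' esz ek; move: vl => /andP[ab _].
  have bb : bounded (w ++ [:: b]) by apply: (bsub _ _ (a :: flat l)).
  have ba : bounded (w ++ [:: a]).
    move=> j; apply: leq_trans (bl j); rewrite !count_cat /=; lia.
  have bx : bounded (w ++ [:: x']) by apply: bsub bl'.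
  have := ek 1%N isT; rewrite /= !prefixes0 /= => e.
  have := e (point (w ++ [:: a])); rewrite !inE eqxx orbT => /esym/eqP/(one _ _ _ ba bx) e1.
  have := e (point (w ++ [:: b])); rewrite !inE eqxx => /esym/eqP/(one _ _ _ bb bx) e2.
  by rewrite e1 e2 ltnn in ab.
- move=> bl bl' esz ek; move: vl vl' => /andP[ab vl] /andP[ab' vl'].
  have bb : bounded (w ++ [:: b]) by apply: (bsub _ _ (a :: flat l)).
  have ba : bounded (w ++ [:: a]).
    move=> j; apply: leq_trans (bl j); rewrite !count_cat /=; lia.
  have bb' : bounded (w ++ [:: b']) by apply: (bsub _ _ (a' :: flat l')).
  have ba' : bounded (w ++ [:: a']).
    move=> j; apply: leq_trans (bl' j); rewrite !count_cat /=; lia.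
  have := ek 1%N isT; rewrite /= => e.
  have e1 : (b == b') || (b == a').
    have := e (point (w ++ [:: b])); rewrite !inE eqxx => /esym/orP[]/eqP.
      by move=> /(one _ _ _ bb bb') ->; rewrite eqxx.
    by move=> /(one _ _ _ bb ba') ->; rewrite eqxx orbT.
  have e2 : (a == b') || (a == a').
    have := e (point (w ++ [:: a])); rewrite !inE eqxx orbT => /esym/orP[]/eqP.
      by move=> /(one _ _ _ ba bb') ->; rewrite eqxx.
    by move=> /(one _ _ _ ba ba') ->; rewrite eqxx orbT.
  have [eb ea] : b = b' /\ a = a'.
    by case/orP: e1 => /eqP e1; case/orP: e2 => /eqP e2; subst; split=> //; exfalso; lia.
  rewrite -eb -ea in ek bl' *; congr (_ :: _).
  apply: (IH _ _ (w ++ [:: b; a])) => //.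
  + by rewrite -catA.
  + by rewrite -catA.
  + by move: esz; rewrite !size_cat /=; lia.
  move=> k kl y; have := ek k.+2 kl y; rewrite /= -!map_comp.
  by congr (_ = _); congr (y \in _); apply: eq_map => s /=; rewrite -catA.
Qed.

Lemma list_cell_inj l l' : good l -> good l' -> list_cell l = list_cell l' -> l = l'.
Proof.
move=> gl gl' e; have [vl cl] := gl; have [vl' cl'] := gl'.
apply: (@list_cell_inj_from [::]) => //.
- by move=> j /=; rewrite cl.
- by move=> j /=; rewrite cl'.
- by rewrite !good_size.
move=> k; rewrite good_size // -ltnS => kl x.
have /ffunP/(_ (Ordinal kl))/setP/(_ x) := e.
by rewrite !ffunE !inE.
Qed.

Section CellLists.
Variable X : Hom_i i.

(** Heights increase strictly along [ell i + 1] ranks and lie between 0 and [ell i], which leaves no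
    slack. *)
Lemma cell_height (a : A) x : x \in X a -> height x = a.
Proof.
have pk (b : A) : exists y, y \in X b by apply/set0Pn/cell_neq0.
have lo k : forall (b : A) y, b = k :> nat -> y \in X b -> (k <= height y)%N.
  elim: k => [//|k IH] b y bk yb.
  have kb : (k < (ell i).+1)%N by rewrite ltnW // -bk.
  have [z zb] := pk (Ordinal kb).
  apply: leq_ltn_trans (IH (Ordinal kb) z erefl zb) _; apply: height_lt.
  by apply: (cell_mono _ zb yb); rewrite ltEord /= bk.
have hi k : forall (b : A) y, (ell i - b = k)%N -> y \in X b -> (height y <= b)%N.
  elim: k => [|k IH] b y bk yb.
    by apply: leq_trans (height_le y) _; lia.
  have kb : (b.+1 < (ell i).+1)%N by lia.
  have [z zb] := pk (Ordinal kb).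
  rewrite -ltnS; apply: leq_trans (IH (Ordinal kb) z _ zb); last by rewrite /=; lia.
  by apply: height_lt; apply: (cell_mono _ yb zb); rewrite ltEord /=.
by move=> xa; apply/eqP; rewrite eqn_leq (hi _ _ _ erefl xa) (lo _ _ _ erefl xa).
Qed.

Lemma bounded_full w : bounded w -> size w = ell i -> forall j, count_mem j w = i j.
Proof.
move=> bw sw; apply: eq_sum_leq => //.
by rewrite -size_count_mem sw.
Qed.

Lemma next_point w (a a' : A) y : bounded w -> size w = a -> a' = a.+1 :> nat ->
    point w \in X a -> y \in X a' ->
  exists2 j, bounded (w ++ [:: j]) & y = point (w ++ [:: j]).
Proof.
move=> bw sw ea wa ya'; apply: point_step => //.
  by apply: (cell_mono _ wa ya'); rewrite ltEord /= ea.
by rewrite (cell_height ya') sw ea.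
Qed.

(* Two distinct elements just above [point w] have only one upper bound two steps
   above it, namely their join, so the cell is again a singleton there. *)
Lemma cell_list_from N w (a : A) :
    (ell i - a < N)%N -> bounded w -> size w = a -> X a = [set point w] ->
  exists l, [/\ valid l, forall j, count_mem j (w ++ flat l) = i j &
    forall (b : A) k, b = (a + k)%N :> nat ->
      X b = [set x in [seq point (w ++ s) | s <- prefixes l k]]].
Proof.
elim: N w a => // N IH w a aN bw sw Xa.
have [ea|al] := eqVneq (a : nat) (ell i).
  exists [::]; split=> //; first by rewrite cats0; apply: bounded_full; rewrite // sw.
  move=> b [|k] bk; last by have := ltn_ord b; lia.
  have -> : b = a by apply: val_inj; rewrite /= bk addn0.
  by rewrite Xa /= cats0; apply/setP => x; rewrite !inE.
have la : (a.+1 < (ell i).+1)%N by have := ltn_ord a; lia.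
pose a1 : A := Ordinal la.
have wa : point w \in X a by rewrite Xa set11.
have next1 y : y \in X a1 ->
    exists2 j, bounded (w ++ [:: j]) & y = point (w ++ [:: j]).
  by apply: next_point wa.
have /set0Pn[y yX] := cell_neq0 X a1.
have [j bj ey] := next1 y yX.
have [one|[y' y'X ny]] : X a1 = [set y] \/ exists2 y', y' \in X a1 & y' != y.
    have [/eqP ->|] := boolP (X a1 == [set y]); first by left.
    rewrite eqEsubset sub1set yX andbT => /subsetPn[y' y'X]; rewrite inE => ny.
    by right; exists y'.
  have [||||l [vl cl lP]] := IH (w ++ [:: j]) a1.
  - by rewrite /=; lia.
  - by [].
  - by rewrite size_cat /= sw addn1.
  - by rewrite one ey.
  exists (inl j :: l); split=> //.
    by move=> k; rewrite flat_cons catA cl.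
  move=> b [|k] bk.
    have -> : b = a by apply: val_inj; rewrite /= bk addn0.
    by rewrite Xa prefixes0 /= cats0; apply/setP => x; rewrite !inE.
  rewrite (lP b k) /= -?map_comp; last by rewrite bk addSnnS.
  apply/setP => x; rewrite !inE; congr (x \in _); apply: eq_map => s /=.
  by rewrite -catA.
have [j' bj' ey'] := next1 y' y'X.
have njj : j != j' by apply: contraNneq ny => e; rewrite ey ey' e.
(* At the top rank both points would be the maximum of the product. *)
have la2 : (a.+2 < (ell i).+1)%N.
  rewrite ltnS ltn_neqAle; apply/andP; split; last by rewrite -ltnS.
  apply/eqP => ea; move/eqP: ny; apply; rewrite ey ey'; apply: eq_point => k.
  rewrite !bounded_full //; by rewrite size_cat /= sw addn1.
pose a2 : A := Ordinal la2.
(* An element two ranks up also lies above [y'], so the letter added after [j] must be [j']. *)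
have X2 z : z \in X a2 -> z = point (w ++ [:: j; j']) /\ bounded (w ++ [:: j; j']).
  move=> zX; rewrite ey in yX.
  have sj : size (w ++ [:: j]) = a1 by rewrite size_cat /= sw addn1.
  have [k bk ez] := next_point bj sj (erefl : a2 = a1.+1 :> nat) yX zX.
  have /ltW/chain_prod_leP/(_ j') : (y' < z)%O by apply: cell_mono y'X zX; rewrite ltEord.
  rewrite ez ey' !pointE // !count_cat /= eqxx (negbTE njj).
  have [ek _|] := eqVneq k j'; last by lia.
  by move: bk; rewrite ek -catA.
have /set0Pn[z zX] := cell_neq0 X a2; have [ez bz] := X2 z zX.
have X2E : X a2 = [set point (w ++ [:: j; j'])].
  apply/setP => x; rewrite inE; apply/idP/eqP => [/X2[]//|->].
  by rewrite -ez.
have X1E : X a1 = [set point (w ++ [:: j]); point (w ++ [:: j'])].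
  apply/setP => x; rewrite !inE; apply/idP/orP => [xX|]; last first.
    by move=> [] /eqP->; rewrite -?ey -?ey'.
  have [k bk ex] := next1 x xX.
  have /ltW/chain_prod_leP/(_ k) : (x < z)%O by apply: cell_mono xX zX; rewrite ltEord.
  rewrite ez ex !pointE // !count_cat /= eqxx.
  have [-> _|nk] := eqVneq j k; first by left.
  have [-> _|nk'] := eqVneq j' k; first by right.
  by rewrite leq_add2l.
have pairs (b c : 'I_n) : (c < b)%N ->
    (b = j /\ c = j') \/ (b = j' /\ c = j) ->
  exists l, [/\ valid l, forall j, count_mem j (w ++ flat l) = i j &
    forall (b : A) k, b = (a + k)%N :> nat ->
      X b = [set x in [seq point (w ++ s) | s <- prefixes l k]]].
  move=> cb bc.
  have ct k : count_mem k (w ++ [:: b; c]) = count_mem k (w ++ [:: j; j']).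
    by case: bc => -[-> ->]; rewrite // !count_cat; congr (_ + _)%N; rewrite /= addnCA.
  have [||||l [vl cl lP]] := IH (w ++ [:: b; c]) a2; rewrite ?X2E /=.
  - by lia.
  - by move=> k; rewrite ct.
  - by rewrite size_cat /= sw addn2.
  - by rewrite (eq_point ct).
  exists (inr (b, c) :: l); split.
  - by rewrite /valid /= cb.
  - by move=> k; rewrite flat_cons catA cl.
  move=> d [|[|k]] dk.
  - have -> : d = a by apply: val_inj; rewrite /= dk addn0.
    by rewrite Xa /= cats0; apply/setP => x; rewrite !inE.
  - have -> : d = a1 by apply: val_inj; rewrite /= dk addn1.
    rewrite X1E /=; apply/setP => x; rewrite !inE.
    by case: bc => -[-> ->] //; rewrite orbC.
  rewrite (lP d k) /= -?map_comp; last by rewrite dk !addSnnS.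
  apply/setP => x; rewrite !inE; congr (x \in _); apply: eq_map => s /=.
  by rewrite -catA.
case: (ltngtP j j') => jj'.
- by apply: (pairs j' j) => //; right.
- by apply: (pairs j j') => //; left.
- by move: njj; rewrite -val_eqE /= jj' eqxx.
Qed.

Lemma cell_list_ex : exists2 l, good l & cell_val X = list_cell l.
Proof.
have b0 : bounded [::] by [].
have x0 x : x \in X ord0 -> x = point [::].
  move=> /cell_height/eqP; rewrite sum_nat_eq0 => /forallP h.
  by apply/ffunP => j; apply: val_inj; rewrite /= pointE //; apply/eqP/h.
have X0 : X ord0 = [set point [::]].
  have /set0Pn[x xX] := cell_neq0 X ord0.
  apply/setP => y; rewrite inE; apply/idP/eqP => [/x0//|->].
  by rewrite -(x0 x xX).
have [||||l [vl cl lP]] := @cell_list_from (ell i).+1 [::] ord0 => //=.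
- by rewrite subn0.
exists l => //; apply/ffunP => a; rewrite (lP a a) // ffunE.
by apply/setP => x; rewrite !inE.
Qed.

End CellLists.

(** * Orientations and incidence numbers *)

(** One sign per pair, comparing the enumeration order of its two vertices with the decreasing order
    of its letters; these signs carry [cell_incidence] over to [list_bd]. *)
Fixpoint orientation w l : int :=
  match l with
  | [::] => 1
  | inl x :: l' => orientation (w ++ [:: x]) l'
  | inr (b, a) :: l' =>
      (-1) ^+ (enum_rank (point (w ++ [:: b])) < enum_rank (point (w ++ [:: a])))%N
      * orientation (w ++ [:: b; a]) l'
  end.

Lemma orientation_sqr w l : orientation w l * orientation w l = 1.
Proof.
elim: l w => [|[x|[b a]] l IH] w /=; rewrite ?mulr1 //.
by rewrite mulrACA IH mulr1 -expr2 sqrr_sign.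
Qed.

Lemma eq_orientation w w' l : (forall j, count_mem j w = count_mem j w') ->
  orientation w l = orientation w' l.
Proof.
elim: l w w' => [|[x|[b a]] l IH] w w' e //=.
  by apply: IH => j; rewrite !count_cat e.
have ep s : point (w ++ s) = point (w' ++ s).
  by apply: eq_point => j; rewrite !count_cat e.
by rewrite !ep; congr (_ * _); apply: IH => j; rewrite !count_cat e.
Qed.

Lemma orientation_split w u v (b a : 'I_n) :
  let eps := (-1) ^+ (enum_rank (point ((w ++ flat u) ++ [:: b])) <
                      enum_rank (point ((w ++ flat u) ++ [:: a])))%N in
  orientation w (u ++ inr (b, a) :: v) =
    eps * orientation w (u ++ inl b :: inl a :: v) /\
  orientation w (u ++ inr (b, a) :: v) =
    eps * orientation w (u ++ inl a :: inl b :: v).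
Proof.
elim: u w => [|[x|[d c]] u IH] w /=.
- rewrite cats0 -!catA; split=> //; congr (_ * _); apply: eq_orientation => j.
  by rewrite !count_cat; congr (_ + _)%N; rewrite /= !addn0 addnC.
- by have := IH (w ++ [:: x]); rewrite -!catA.
- by have [e1 e2] := IH (w ++ [:: d; c]); split; [rewrite e1|rewrite e2]; rewrite -!catA mulrCA.
Qed.

Lemma enum_rank_ordE (m : nat) (a : 'I_m) : enum_rank a = a :> nat.
Proof. by rewrite enum_rank_ord. Qed.

Lemma sum_before_pair (Y : Hom_i i) u v (b a : 'I_n) (p : A) :
    good (u ++ inr (b, a) :: v) -> p = (size (flat u)).+1 :> nat ->
    cell_val Y = list_cell (u ++ inr (b, a) :: v) ->
  (\sum_(a' : A | (enum_rank a' < enum_rank p)%N) #|Y a'|.-1)%N = npairs u.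
Proof.
move=> gl ep eY; rewrite -(sum_prefixes u (inr (b, a) :: v)) -ep big_mkord.
rewrite (big_ord_widen _
  (fun k => (size (prefixes (u ++ inr (b, a) :: v) k)).-1) (ltnW (ltn_ord p))).
apply: eq_big => [k|k _]; first by rewrite !enum_rank_ordE.
by rewrite eY card_list_cell.
Qed.

Lemma rank_before_pair (T : finType) (y y' : T) : y != y' ->
  #|[set b in [set y; y'] | (enum_rank b < enum_rank y')%N]| =
  (enum_rank y < enum_rank y')%N.
Proof.
move=> ny; have [lt|ge] := ltnP (enum_rank y) (enum_rank y').
  rewrite (_ : [set _ in _ | _] = [set y]) ?cards1 //; apply/setP => x; rewrite !inE.
  by have [->|] := eqVneq x y; rewrite //=; have [->|] := eqVneq x y'; rewrite ?ltnn.
rewrite (_ : [set _ in _ | _] = set0) ?cards0 //; apply/setP => x; rewrite !inE.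
have [->|] := eqVneq x y; first by rewrite ltnNge ge.
by have [->|] := eqVneq x y'; rewrite ?ltnn.
Qed.

Lemma incidence_split (X Y : Hom_i i) u v (b a : 'I_n) :
    good (u ++ inr (b, a) :: v) ->
    cell_val Y = list_cell (u ++ inr (b, a) :: v) ->
  let o l := orientation [::] l in
  let ly := u ++ inr (b, a) :: v in
  (cell_val X = list_cell (u ++ inl b :: inl a :: v) ->
     covered X Y /\
     cell_incidence Y X = o ly * o (u ++ inl b :: inl a :: v) * (-1) ^+ npairs u) /\
  (cell_val X = list_cell (u ++ inl a :: inl b :: v) ->
     covered X Y /\
     cell_incidence Y X = - (o ly * o (u ++ inl a :: inl b :: v) * (-1) ^+ npairs u)).
Proof.
move=> gl eY o ly.
have pl : ((size (flat u)).+1 < (ell i).+1)%N.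
  by rewrite -(good_size gl) flat_cat flat_cons !size_cat /=; lia.
pose p : A := Ordinal pl.
have [Yp r1 r2] := list_cell_split gl (erefl : p = (size (flat u)).+1 :> nat) eY.
have np := point_pair_neq gl.
have [o1 o2] := orientation_split [::] u v b a.
have yb : point (flat u ++ [:: b]) \in Y p by rewrite Yp !inE eqxx.
have ya : point (flat u ++ [:: a]) \in Y p by rewrite Yp !inE eqxx orbT.
split=> eX.
  have eX' : cell_val X = remove_vertex Y p (point (flat u ++ [:: a])) by rewrite eX.
  split; first exact: remove_covered eX'.
  rewrite (cell_incidence_remove ya eX') (sum_before_pair gl _ eY) //.
  rewrite Yp rank_before_pair // exprD /o /ly o1.
  rewrite -[_ * _ * orientation _ _]mulrA orientation_sqr mulr1.
  by rewrite mulrC.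
have eX' : cell_val X = remove_vertex Y p (point (flat u ++ [:: b])) by rewrite eX.
split; first exact: remove_covered eX'.
rewrite (cell_incidence_remove yb eX') (sum_before_pair gl _ eY) //.
rewrite Yp setUC rank_before_pair; last by rewrite eq_sym.
rewrite exprD /o /ly o2 -[_ * _ * orientation _ _]mulrA orientation_sqr mulr1.
rewrite mulrC -mulNr /=; congr (_ * _).
(* The vertices have different ranks, so exchanging them flips the comparison; this is the minus
   sign in ba - ab. *)
have : enum_rank (point (flat u ++ [:: b])) != enum_rank (point (flat u ++ [:: a])) :> nat.
  by rewrite val_eqE (inj_eq enum_rank_inj).
by case: ltngtP => // _ _; rewrite ?opprK.
Qed.

Lemma covered_split (X Y : Hom_i i) ly : good ly -> cell_val Y = list_cell ly ->
  covered X Y -> exists2 lx, face lx ly & cell_val X = list_cell lx.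
Proof.
move=> gl eY /covered_remove[p [y yY eX]].
have pl : (p <= size (flat ly))%N by rewrite good_size // -ltnS.
case: (prefixesP pl) => [w e|u v b a e1 e2].
  have Yp : Y p = [set point w] by rewrite eY ffunE e; apply/setP => x; rewrite !inE.
  have /set0Pn[x] := cell_neq0 X p.
  rewrite eX remove_vertexE eqxx Yp !inE; move: yY; rewrite Yp inE => /eqP ->.
  by rewrite andNb.
rewrite e1 in gl eY *.
have [Yp r1 r2] := list_cell_split gl e2 eY.
have [ab _ _] := good_pair_prefix gl.
move: yY; rewrite Yp !inE => /orP[]/eqP ey; rewrite ey in eX.
  by exists (u ++ inl a :: inl b :: v); [right; exists u, v, b, a | rewrite eX].
by exists (u ++ inl b :: inl a :: v); [left; exists u, v, b, a | rewrite eX].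
Qed.

(** * Transfer of the matching and the cycles to Hom(i) *)

Section ListMatching.
Variable L : Hom_i i -> seq block.
Hypothesis L_good : forall X, good (L X).
Hypothesis L_cell : forall X, cell_val X = list_cell (L X).
Implicit Types X Y Z : Hom_i i.

Local Notation o := (orientation [::]).

Definition list_inc : Hom_i i -> Hom_i i -> int := fun Y X => cell_incidence Y X.

Lemma L_inj : injective L.
Proof. by move=> X Y e; apply: val_inj; rewrite /= !L_cell e. Qed.

Lemma L_surj l : good l -> exists X, L X = l.
Proof.
move=> gl; exists (HomCell (list_cell_is_cell gl)).
by apply: list_cell_inj => //; rewrite -L_cell.
Qed.

Lemma L_dim X : cell_dim X = npairs (L X).
Proof. exact: dim_list_cell. Qed.

Lemma L_incidence X Y : face (L X) (L Y) ->
  covered X Y /\ list_inc Y X = o (L Y) * o (L X) * list_bd (delta (L Y)) (L X).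
Proof.
have eX := L_cell X; have eY := L_cell Y; have gY := L_good Y.
move: eX eY gY; move: (L X) (L Y) => lx ly eX eY gY.
move=> [] [u [v [b [a [ab ey ex]]]]]; rewrite ey in eY gY *; rewrite ex in eX *.
  have [/(_ eX)[cov e] _] := incidence_split X gY eY; split=> //.
  by rewrite /list_inc e list_bd_delta_cat (list_bd_delta_pair _ ab).1 mulr1.
have [_ /(_ eX)[cov e]] := incidence_split X gY eY; split=> //.
by rewrite /list_inc e list_bd_delta_cat (list_bd_delta_pair _ ab).2 mulrN1 mulrN.
Qed.

Lemma covered_face X Y : covered X Y <-> face (L X) (L Y).
Proof.
split=> [cov|/L_incidence[]//].
have [lx fx eX] := covered_split (L_good Y) (L_cell Y) cov.
suff -> : L X = lx by [].
apply: list_cell_inj; rewrite -?L_cell //.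
exact: (good_face fx).2 (L_good Y).
Qed.

Lemma list_incE X Y : list_inc Y X = o (L Y) * o (L X) * list_bd (delta (L Y)) (L X).
Proof.
have [/L_incidence[]//|nf] := pselect (face (L X) (L Y)).
rewrite list_bd_delta_eq0 // mulr0; apply/eqP; apply: contraT.
by move=> /cell_incidence_covered/covered_face.
Qed.

(** The signs [o] identify cellular chains with functions on lists, so identities for [list_bd] pass
    to [chain_bd]. *)
Lemma chain_bd_list (c : {ffun Hom_i i -> int}) (ct : seq block -> int) X :
  (forall Y, c Y = o (L Y) * ct (L Y)) ->
  chain_bd list_inc c X = o (L X) * list_bd ct (L X).
Proof.
move=> cE; rewrite ffunE.
rewrite (eq_bigr (fun Y => o (L X) * (ct (L Y) * list_bd (delta (L Y)) (L X)))).
  rewrite -mulr_sumr; congr (_ * _).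
  rewrite -(@list_bd_sum n (Hom_i i) _ _ (fun Y => ct (L Y)) (fun Y => delta (L Y))).
  apply: eq_list_bd => m /good_face[gm _]; have [Z <-] := L_surj (gm (L_good X)).
  rewrite (bigD1 Z) //= big1 => [|Y YZ]; first by rewrite addr0 /delta eqxx mulr1.
  by rewrite /delta (inj_eq L_inj) eq_sym (negbTE YZ) mulr0.
move=> Y _; rewrite cE list_incE.
transitivity (o (L Y) * o (L Y) * (o (L X) * (ct (L Y) * list_bd (delta (L Y)) (L X)))).
  by ring.
by rewrite orientation_sqr mul1r.
Qed.

Lemma chain_bd_bd (c : {ffun Hom_i i -> int}) :
  chain_bd list_inc (chain_bd list_inc c) = 0.
Proof.
pose ct m := \sum_Y delta (L Y) m * (o (L Y) * c Y).
have cE Y : c Y = o (L Y) * ct (L Y).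
  rewrite /ct (bigD1 Y) //= big1 => [|Z ZY].
    by rewrite addr0 /delta eqxx mul1r mulrA orientation_sqr mul1r.
  by rewrite /delta (inj_eq L_inj) eq_sym (negbTE ZY) mul0r.
apply/ffunP => X; rewrite (chain_bd_list (ct := list_bd ct)) ?list_bd_bd ?mulr0 ?ffunE //.
by move=> Y; rewrite (chain_bd_list (ct := ct)).
Qed.

Definition list_matching : {set Hom_i i * Hom_i i} :=
  [set p | up (L p.1) == Some (L p.2)].

Local Notation M := list_matching.

Lemma list_matching_up p : p \in M -> up (L p.1) = Some (L p.2).
Proof. by rewrite inE => /eqP. Qed.

Lemma list_matchingP : matching M.
Proof.
split=> [p /list_matching_up pM|p q /list_matching_up pM /list_matching_up qM pq].
  by apply/covered_face; left; apply: up_keep_face.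
have [dp up_p _] := up_spec pM; have [dq uq _] := up_spec qM.
split; apply: contraNneq pq => e.
- apply/eqP; case: p q e pM qM {dp dq up_p uq} => [p1 p2] [q1 q2] /= -> ->.
  by move=> [/L_inj ->].
- by rewrite e uq in pM.
- by rewrite -e up_p in qM.
- apply/eqP; case: p q e dp dq {pM qM up_p uq} => [p1 p2] [q1 q2] /= -> ->.
  by move=> [/L_inj ->].
Qed.

Definition cell_wgt X : nat := wgt (flat (L X)).

Lemma list_filtration : filtration M cell_wgt.
Proof.
split=> [X Y /covered_face/face_wgt //|p /list_matching_up/up_keep_face/keep_face_flat].
by rewrite /cell_wgt => ->.
Qed.

(** Weight and merge position in lexicographic order, coded in base [ell i + 1] because the position
    is at most [ell i]. Through a face with another word the weight drops; otherwise
    [merge_pos_decr] applies. *)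
Lemma list_potential : decreasing_potential M
  (fun p => cell_wgt p.1 * (ell i).+1 + merge_pos (L p.1))%N.
Proof.
move=> p q pM qM pq /covered_face fc.
have [fm1 fm2] := list_filtration; rewrite (fm2 p pM).
have mq := merge_pos_le (L q.1); rewrite good_size // in mq.
case: fc => [kf|/swap_face_wgt lt]; last first.
  have h := leq_mul lt (leqnn (ell i).+1); rewrite mulSn in h.
  apply: leq_trans (leq_trans h (leq_addr _ _)).
  by rewrite addnC ltn_add2r ltnS.
rewrite /cell_wgt (keep_face_flat kf) ltn_add2l.
apply: merge_pos_decr (list_matching_up pM) kf _ _.
  move=> /L_inj e; move/eqP: pq; apply; apply/esym.
  exact: (matching_inj1 list_matchingP qM pM).
by rewrite (list_matching_up qM).
Qed.

Lemma list_critical X : (X \in critical M) = crit (L X).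
Proof.
apply/idP/idP => [|/andP[/eqP u0 /eqP d0]]; last first.
  apply: contraT => /criticalPn[p pM [e|e]].
    by move: u0; rewrite e (list_matching_up pM).
  by have [] := up_spec (list_matching_up pM); rewrite -e d0.
apply: contraTT; rewrite negb_and => /orP[]; case e: (_ (L X)) => [m|] // _.
  have fc : face (L X) m by left; apply: up_keep_face.
  have [Z eZ] := L_surj ((good_face fc).1 (L_good X)).
  by apply/criticalPn; exists (X, Z); [rewrite inE /= eZ e | left].
have [vX _] := L_good X.
have fc : face m (L X) by left; apply: down_keep_face.
have [Z eZ] := L_surj ((good_face fc).2 (L_good X)).
by apply/criticalPn; exists (Z, X); [rewrite inE /= eZ (down_spec vX e) | right].
Qed.

Lemma list_critical_cycle X : X \in critical M -> exists z : {ffun Hom_i i -> int},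
  [/\ is_chain (fun X : Hom_i i => cell_dim X) (cell_dim X) z,
      chain_bd list_inc z = 0, z X * z X = 1 &
      forall Y, z Y != 0 -> (cell_wgt X <= cell_wgt Y)%N ->
        Y = X \/ exists2 p, p \in M & Y = p.2].
Proof.
rewrite list_critical => cX; have [vX _] := L_good X.
have [c [c0 c1 cs]] := critical_cycle vX cX.
pose z : {ffun Hom_i i -> int} := [ffun Y => o (L Y) * c (L Y)].
have zE Y : z Y = o (L Y) * c (L Y) by rewrite ffunE.
have cn Y : z Y != 0 -> c (L Y) != 0 by rewrite zE; apply: contraNneq => ->; rewrite mulr0.
exists z; split.
- by apply/is_chainP => Y /cn/cs[_ e _]; rewrite !L_dim.
- by apply/ffunP => Y; rewrite (chain_bd_list (ct := c)) // c0 mulr0 ffunE.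
- by rewrite zE mulrACA orientation_sqr c1.
move=> Y /cn/cs[_ _ h] le; case: h => [lt|[_ [/L_inj|]]]; last 2 first.
- by left.
- have [vY _] := L_good Y; case e: (down (L Y)) => [m|] // _; right.
  have fc : face m (L Y) by left; apply: down_keep_face.
  have [Z eZ] := L_surj ((good_face fc).2 (L_good Y)).
  by exists (Z, Y) => //; rewrite inE /= eZ (down_spec vY e).
by move: le; rewrite /cell_wgt leqNgt lt.
Qed.

Lemma list_word_size X : size (flat (L X)) == ell i.
Proof. by rewrite good_size. Qed.

Definition list_word X : (ell i).-tuple 'I_n := Tuple (list_word_size X).

Lemma list_word_inj : {in critical M &, injective list_word}.
Proof.
move=> X Y; rewrite !list_critical => cX cY /(congr1 val) /= e.
have [[vX _] [vY _]] := (L_good X, L_good Y).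
apply: L_inj; apply: Some_inj.
by rewrite -(crit_word_flat vX cX) -(crit_word_flat vY cY) e.
Qed.

Lemma list_word_parse X : X \in critical M ->
  parse_bits (descent_bits (list_word X)) = Some (cell_dim X).
Proof.
rewrite list_critical => cX; have [vX _] := L_good X.
by rewrite -crit_word_bits /= crit_word_flat //= L_dim.
Qed.

(** Both directions pass through [parse_bits], which succeeds on a word exactly when a run
    decomposition exists; [crit_word] then supplies the critical cell. *)
Lemma list_word_image (w : (ell i).-tuple 'I_n) :
  (exists2 X, X \in critical M & list_word X = w) <->
  multiset_perm w /\ exists s, run_decomposition (Des w) s.
Proof.
split=> [[X cX <-]|[mw [s sP]]].
  split; first by move=> j; have [_ <-] := L_good X.
  apply: (parse_run_decomposition (mem_descents _)).
  by rewrite list_word_parse.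
have := run_decomposition_parse (mem_descents w) sP.
rewrite -crit_word_bits; case e: (crit_word w) => [l|] // _.
have [fl vl cl] := crit_word_spec e.
have [X eX] : exists X, L X = l by apply: L_surj; split=> // j; rewrite fl.
exists X; first by rewrite list_critical eX.
by apply: val_inj; rewrite /= eX.
Qed.

End ListMatching.

Lemma cell_lists : exists2 L : Hom_i i -> seq block,
  (forall X, good (L X)) & (forall X, cell_val X = list_cell (L X)).
Proof.
have [X|L LP] := @choice _ _ (fun X l => good l /\ cell_val X = list_cell l).
  by have [l gl e] := cell_list_ex X; exists l.
by exists L => X; have [] := LP X.
Qed.

End ChainProductCells.

Theorem theorem5p1 (n : nat) (i : 'I_n -> nat)
    (n_gt0 : (0 < n)%N)
    (i_gt0 : forall j : 'I_n, (0 < i j)%N)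
    (i_mono : forall j k : 'I_n, (j <= k)%N -> (i j <= i k)%N) :
  let dim := fun X : Hom_i i => cell_dim X in
  let inc := fun Y X : Hom_i i => cell_incidence Y X in
  exists M : {set Hom_i i * Hom_i i},
  [/\ optimal_matching dim M,
      (forall X Y : Hom_i i, X \in critical M -> Y \in critical M ->
         morse_incidence inc M X Y = 0),
      (forall k : nat,
         free_of_rank (homology dim inc k) #|critical_dim dim M k|)
    & exists phi : Hom_i i -> (ell i).-tuple 'I_n,
      [/\ {in critical M &, injective phi},
          (forall w : (ell i).-tuple 'I_n,
             (exists2 X, X \in critical M & phi X = w) <->
             multiset_perm w /\ exists s, run_decomposition (Des w) s)
        & forall (X : Hom_i i) (s : seq (nat * nat)),
             X \in critical M -> run_decomposition (Des (phi X)) s ->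
             dim X = (\sum_(p <- s) ceil_div3 p.2)%N]].
Proof.
move=> dim inc; have [L gL cL] := cell_lists i.
have inc_cov x y : inc y x != 0 -> covered x y by exact: cell_incidence_covered.
have inc_sq x y : covered x y -> inc y x * inc y x = 1 by exact: cell_incidence_sqr.
have dim_cov x y : covered x y -> dim y = (dim x).+1.
  by move=> /(covered_face gL cL)/face_npairs; rewrite /dim !(L_dim gL cL).
have bd2 c : chain_bd inc (chain_bd inc c) = 0 by exact: chain_bd_bd gL cL c.
have mM := list_matchingP gL cL; have rhoP := list_potential gL cL.
(* The dual cycles carry the first three claims; the bijection rests on the combinatorics of
   lists. *)
have [Y YP] := dual_cycles inc_cov inc_sq dim_cov bd2 mM rhoP
  (list_filtration gL cL) (list_critical_cycle gL cL).
exists (list_matching L); split.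
- split; first exact: potential_acyclic mM rhoP.
  move=> M' acM' k; have [rho' rhoP'] := acyclic_potential acM'.
  exact: (critical_card_le inc_cov inc_sq dim_cov bd2 k mM rhoP YP acM'.1 rhoP').
- by move=> X Z cX _; apply: (dual_cycle_incidence inc_cov inc_sq mM rhoP Z cX (YP X cX)).
- by move=> k; apply: (homology_free inc_cov inc_sq dim_cov bd2 mM rhoP YP).
exists (list_word gL); split.
- exact: list_word_inj.
- exact: list_word_image.
- move=> X s cX /(run_decomposition_parse (mem_descents _)).
  by rewrite (list_word_parse gL cL cX) => -[].
Qed.
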